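(* Let $V$ be a vertex operator superalgebra. For $u,v\in V$ homogeneous (for both weight and parity), $$x_0^{-1}\delta\!\left(\frac{e^{y_{2,1}}x_1}{x_0}\right)X(u,x_1)X(v,x_2)-\epsilon_{u,v}\,x_0^{-1}\delta\!\left(\frac{-e^{y_{1,2}}x_2}{x_0}\right)X(v,x_2)X(u,x_1)$$ $$=x_1^{-1}\delta_{\mathrm{rel}(u)}\!\left(\frac{e^{y}x_2}{x_1}\right)X(Y[u,y]v,x_2),$$ where $$y_{2,1}=\log\left(1-\frac{x_2}{x_1}\right),\qquad y_{1,2}=\log\left(1-\frac{x_1}{x_2}\right),\qquad y=\log\left(1+\frac{x_0}{x_2}\right).$$ Moreover, for homogeneous $u_1,v_1,u_2,v_2\in V$ the following (super)commutator formula holds: $$[X(Y[u_1,x_1]v_1,y_1),X(Y[u_2,x_2]v_2,y_2)]$$ $$=\mathrm{Res}_{y}\ \delta_{\mathrm{rel}(u_1)+\mathrm{rel}(v_1)}\!\left(\frac{e^{y}y_2}{y_1}\right)X(Y[Y[u_1,x_1]v_1,y]\,Y[u_2,x_2]v_2,\,y_2),$$ where in the last formula $x_1,x_2,y_1,y_2,y$ are independent formal variables.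
   Context: $V$ is a vertex operator superalgebra graded by weights (eigenvalues of $L(0)$) in $\frac12\mathbb{Z}$, with a parity $p$ (it is not assumed that parity is determined by the weight mod $\mathbb{Z}$), satisfying the super Jacobi identity $$x_0^{-1}\delta\left(\tfrac{x_1-x_2}{x_0}\right)Y(u,x_1)Y(v,x_2)-\epsilon_{u,v}x_0^{-1}\delta\left(\tfrac{x_2-x_1}{-x_0}\right)Y(v,x_2)Y(u,x_1)=x_2^{-1}\delta\left(\tfrac{x_1-x_0}{x_2}\right)Y(Y(u,x_0)v,x_2),$$ where $\epsilon_{u,v}=(-1)^{p(u)p(v)}$ and binomial expressions are expanded in nonnegative powers of the second variable. Notation: - $\delta(x)=\sum_{n\in\mathbb{Z}}x^n$ and $\delta_r(x)=x^r\delta(x)$ for $r\in\mathbb{Q}$. - $X(u,x)=Y(x^{L(0)}u,x)$, extended coefficientwise when $u$ is replaced by a formal series with coefficients in $V$. - $Y[u,x]=Y(e^{xL(0)}u,e^x-1)$, where negative powers of $e^x-1$ are expanded as Laurent series in $x$. For $y=\log(1+x_0/x_2)$ this means $Y[u,y]=Y((1+x_0/x_2)^{L(0)}u,x_0/x_2)$. - $\mathrm{rel}(u)=\mathrm{wt}(u)-[\mathrm{wt}(u)]\in\{0,\frac12\}$ for $u$ of weight $\mathrm{wt}(u)$, where $[\cdot]$ is the integer part. - Logarithms and exponentials are formal; in particular $e^{y_{2,1}}x_1=x_1-x_2$, expanded in nonnegative powers of $x_2$ in $\delta$, and $-e^{y_{1,2}}x_2=-x_2+x_1$, expanded in nonnegative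 powers of $x_1$. - $[\cdot,\cdot]$ denotes the supercommutator, and $\mathrm{Res}_y$ the coefficient of $y^{-1}$. *)

(* Defs.v *)
From HB Require Import structures.
From mathcomp Require Export all_boot all_order all_algebra.
From mathcomp Require Export sesquilinear.
From mathcomp Require Export boolp classical_sets functions cardinality fsbigop.
Set Implicit Arguments.
Unset Strict Implicit.
Unset Printing Implicit Defensive.
Export Order.TTheory GRing.Theory Num.Theory.
Local Open Scope classical_set_scope.
Local Open Scope ring_scope.

(* A formal series in the commuting variables z_0, ..., z_(n-1), with rational
   exponents and coefficients in M, is its coefficient function on exponent
   vectors e : 'rV[rat]_n; there is no support condition, as delta-function
   calculus requires. Monomials are written additively: the vector
   r *: zvar i + s *: zvar j stands for z_i^r z_j^s.
   Infinite sums are the finite-support sums \sum_(i \in A) F i of fsbigop,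
   which are 0 when infinitely many F i are nonzero. *)
Notation fseries n M := ('rV[rat]_n -> M).

Section FormalSeries.
Variables (F : fieldType) (n : nat).

Definition zvar (i : 'I_n) : 'rV[rat]_n := delta_mx 0 i.

Definition fmono (m : 'rV[rat]_n) : fseries n F := fun e => (e == m)%:R.

Definition fconst (M : zmodType) (v : M) : fseries n M :=
  fun e => if e == 0 then v else 0.

(* z^m f *)
Definition fshift (M : zmodType) (m : 'rV[rat]_n) (f : fseries n M) :
  fseries n M := fun e => f (e - m).

(* The product f g exists when each of its coefficients is a finite sum. *)
Definition fmulable (M : lmodType F) (f : fseries n F) (g : fseries n M) :=
  forall e, finite_set [set d | f d *: g (e - d) != 0].

Definition fmul (M : lmodType F) (f : fseries n F) (g : fseries n M) :
  fseries n M := fun e => \sum_(d \in [set: 'rV[rat]_n]) f d *: g (e - d).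

Definition Res (M : zmodType) (i : 'I_n) (f : fseries n M) : fseries n M :=
  fun e => if e 0 i == 0 then f (e - zvar i) else 0.

End FormalSeries.

Arguments zvar {n} i.
Arguments fmono {F n} m.
Arguments fconst {n M} v.

(* Power series in one variable t, as coefficient sequences. *)
Section PowerSeries.
Variable F : fieldType.

Definition gbinom (r : F) (k : nat) : F :=
  (\prod_(i < k) (r - i%:R)) / k`!%:R.

Definition psmul (f g : nat -> F) : nat -> F :=
  fun k => \sum_(i < k.+1) f i * g (k - i)%N.

(* sum_k a_k g^k, for g without constant term: truncating at t^m does not
   affect the coefficient of t^m *)
Definition pscomp (a g : nat -> F) : nat -> F := fun m =>
  (\sum_(k < m.+1) a k *: (\poly_(i < m.+1) g i) ^+ k)`_m.

(* e^(s g), for g without constant term *)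
Definition psexp (s : F) (g : nat -> F) : nat -> F :=
  pscomp (fun k => s ^+ k / k`!%:R) g.

(* h^s, for h with constant term 1 *)
Definition pspow (s : F) (h : nat -> F) : nat -> F :=
  pscomp (gbinom s) (fun k => if k == 0%N then 0 else h k).

Definition pst : nat -> F := fun k => (k == 1%N)%:R.

(* log(1 + c t) *)
Definition pslog1p (c : F) : nat -> F :=
  fun k => if k == 0%N then 0 else - ((- c) ^+ k / k%:R).

(* The coefficient of t^k in the Laurent series e^(s y) (e^y - 1)^p, for
   y = t + O(t^2): here e^y - 1 = t h with h = 1 + O(t), and (e^y - 1)^p is
   t^p h^p. *)
Definition exp_laurent (y : nat -> F) (s : F) (p k : int) : F :=
  let h i := psexp 1 y i.+1 in
  if p <= k then psmul (psexp s y) (pspow p%:~R h) `|k - p|%N else 0.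

End PowerSeries.

Arguments pst {F}.

Section Delta.
Variables (F : fieldType) (n : nat).

(* f(z^nu) *)
Definition pssubst (nu : 'rV[rat]_n) (f : nat -> F) : fseries n F :=
  fun e => \sum_(k \in [set: nat]) f k * fmono (k%:R *: nu) e.

(* (z^a - z^b)^m, in nonnegative powers of z^b *)
Definition binom_expansion (a b : 'rV[rat]_n) (m : int) : fseries n F :=
  fun e => \sum_(k \in [set: nat])
    (-1) ^+ k * gbinom (m%:~R : F) k * fmono ((m%:~R - k%:R) *: a + k%:R *: b) e.

(* delta((z^a - z^b) / (c z^d)), for c = 1 or c = -1 *)
Definition delta_diff (c : F) (a b d : 'rV[rat]_n) : fseries n F :=
  fun e => \sum_(m \in [set: int])
    c ^ m * fshift (- (m%:~R *: d)) (binom_expansion a b m) e.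

(* delta_r(c e^y z^mu) = sum_m (c e^y z^mu)^(m + r), where y = y(z^nu).
   The constant c is 1, or r = 0, so that c^(m + r) = c^m. *)
Definition delta_exp (r : rat) (c : F) (y : nat -> F) (nu mu : 'rV[rat]_n) :
  fseries n F :=
  fun e => \sum_(m \in [set: int])
    c ^ m * fshift ((m%:~R + r) *: mu)
              (pssubst nu (psexp (m%:~R + ratr r) y)) e.

End Delta.

(* Series with coefficients in End V. *)
Section Operators.
Variables (F : fieldType) (V : lmodType F) (n : nat).

Definition opmul (P Q : fseries n (V -> V)) : fseries n (V -> V) :=
  fun e w => \sum_(d \in [set: 'rV[rat]_n]) P d (Q (e - d) w).

(* For P v r the coefficient of x^r in an operator series P(v, x), the series
   P(a, z^x), extended coefficientwise to a series a with coefficients in V. *)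
Definition opextend (P : V -> rat -> V -> V) (a : fseries n V)
    (x : 'rV[rat]_n) : fseries n (V -> V) :=
  fun e w => \sum_(s \in [set: rat]) P (a (e - s *: x)) s w.

End Operators.

Section Modes.
Variables (F : fieldType) (V : lmodType F).
Variable md : int -> {bilinear V -> V -> V}.

(* The coefficient of x^r in Y(u, x) = sum_m u_m x^(-m-1), where u_m = md m u. *)
Definition Ycoef (u : V) (r : rat) (w : V) : V :=
  if r \is a Num.int then md (- Num.floor r - 1) u w else 0.

Definition Yser (n : nat) := @opextend F V n Ycoef.

(* Super Jacobi identity, for the parity projections par false (even part)
   and par true (odd part). *)
Definition super_jacobi (par : bool -> {linear V -> V}) : Prop :=
  let x0 : 'rV[rat]_3 := zvar 0 in
  let x1 : 'rV[rat]_3 := zvar 1 in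
  let x2 : 'rV[rat]_3 := zvar 2 in
  forall (p q : bool) (u v w : V), par p u = u -> par q v = v ->
  forall e : 'rV[rat]_3,
    fmul (fshift (- x0) (delta_diff 1 x1 x2 x0))
         (opmul (Yser (fconst u) x1) (Yser (fconst v) x2) ^~ w) e
    - (-1) ^+ (p && q) *:
      fmul (fshift (- x0) (delta_diff (-1) x2 x1 x0))
           (opmul (Yser (fconst v) x2) (Yser (fconst u) x1) ^~ w) e
    = fmul (fshift (- x2) (delta_diff 1 x1 x0 x2))
           (Yser (Yser (fconst u) x0 ^~ v) x2 ^~ w) e.

End Modes.

(* Vertex operator superalgebras. The weight and parity gradings are given by
   the projections onto their components. No relation between weights mod Z
   and parities is imposed. *)
Record vosa (F : fieldType) (V : lmodType F) := VOSA {
  wtproj : rat -> {linear V -> V};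
  parproj : bool -> {linear V -> V};
  mode : int -> {bilinear V -> V -> V};
  vacuum : V;
  conformal : V;
  central_charge : F;

  wtprojM : forall h k v,
    wtproj h (wtproj k v) = if h == k then wtproj k v else 0;
  wtproj_finite : forall v, finite_set [set h | wtproj h v != 0];
  wtproj_sum : forall v, \sum_(h \in [set: rat]) wtproj h v = v;
  wt_half_integer : forall h v, wtproj h v != 0 -> h *+ 2 \is a Num.int;
  wt_bounded_below : exists N : rat, forall h v, h < N -> wtproj h v = 0;
  wt_finite_dim : forall h, exists s : seq V, forall v, wtproj h v = v ->
    exists c : nat -> F, v = \sum_(i < size s) c i *: s`_i;

  parprojM : forall p q v,
    parproj p (parproj q v) = if p == q then parproj q v else 0;
  parproj_sum : forall v, parproj false v + parproj true v = v;
  parproj_wtproj : forall p h v,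
    parproj p (wtproj h v) = wtproj h (parproj p v);
  mode_parity : forall p q m u v, parproj p u = u -> parproj q v = v ->
    parproj (p (+) q) (mode m u v) = mode m u v;

  mode_truncation : forall u v, exists N : int, forall m, N <= m ->
    mode m u v = 0;
  vacuum_parity : parproj false vacuum = vacuum;
  vacuum_weight : wtproj 0 vacuum = vacuum;
  vacuum_mode : forall m v, mode m vacuum v = if m == -1 then v else 0;
  creation_regular : forall m v, 0 <= m -> mode m v vacuum = 0;
  creation : forall v, mode (-1) v vacuum = v;

  jacobi : super_jacobi mode parproj;

  conformal_parity : parproj false conformal = conformal;
  conformal_weight : wtproj 2 conformal = conformal;
  virasoro : forall (a b : int) (v : V),
    let L (m : int) := mode (m + 1) conformal in
    L a (L b v) - L b (L a v) = (a - b)%:~R *: L (a + b) v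
      + (if a + b == 0 then (a ^+ 3 - a)%:~R / 12%:R * central_charge else 0)
        *: v;
  L0_weight : forall h v, wtproj h v = v -> mode 1 conformal v = ratr h *: v;
  Lm1_derivative : forall m u v,
    mode m (mode 0 conformal u) v = - (m%:~R *: mode (m - 1) u v)
}.

Section VOSA.
Variables (F : fieldType) (V : lmodType F) (A : vosa V).

Definition homogeneous (h : rat) (p : bool) (u : V) : Prop :=
  wtproj A h u = u /\ parproj A p u = u.

(* The coefficient of x^s in X(u, x) = Y(x^L(0) u, x). *)
Definition Xcoef (u : V) (s : rat) (w : V) : V :=
  \sum_(h \in [set: rat]) Ycoef (mode A) (wtproj A h u) (s - h) w.

Definition X (n : nat) := @opextend F V n Xcoef.

(* The coefficient of t^k in Y[u, y] v = Y(e^(y L(0)) u, e^y - 1) v, for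
   y = t + O(t^2) a power series in t. *)
Definition Ybcoef (y : nat -> F) (u v : V) (k : int) : V :=
  \sum_(h \in [set: rat]) \sum_(m \in [set: int])
    exp_laurent y (ratr h) (- m - 1) k *: mode A m (wtproj A h u) v.

(* Y[a, y] b for y = y(z^nu), extended coefficientwise to series a and b with
   coefficients in V. *)
Definition Yb (n : nat) (a : fseries n V) (y : nat -> F) (nu : 'rV[rat]_n)
    (b : fseries n V) : fseries n V :=
  fun e => \sum_(d \in [set: 'rV[rat]_n]) \sum_(k \in [set: int])
    Ybcoef y (a d) (b (e - d - k%:~R *: nu)) k.

(* The component of parity p of an endomorphism. *)
Definition endpar (p : bool) (f : V -> V) : V -> V :=
  fun w => \sum_(q : bool) parproj A (p (+) q) (f (parproj A q w)).

Definition supercomm (f g : V -> V) : V -> V :=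
  fun w => \sum_(p : bool) \sum_(q : bool)
    (endpar p f (endpar q g w)
     - (-1) ^+ (p && q) *: endpar q g (endpar p f w)).

Definition fsupercomm (n : nat) (P Q : fseries n (V -> V)) :
  fseries n (V -> V) :=
  fun e w => \sum_(d \in [set: 'rV[rat]_n]) supercomm (P d) (Q (e - d)) w.

End VOSA.

Definition rel (h : rat) : rat := h - (Num.floor h)%:~R.

(* Main.v *)
From HB Require Import structures.
Require Import Defs.
From mathcomp Require Import ring lra zify.
Set Implicit Arguments.
Unset Strict Implicit.
Unset Printing Implicit Defensive.
Local Open Scope classical_set_scope.
Local Open Scope ring_scope.

(** The first identity is the Jacobi identity of V multiplied by
    x1^wt(u) x2^wt(v). As e^(y21) x1 = x1 - x2 and e^(y12) x2 = x2 - x1, the two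
    delta functions on the left are unchanged [delta_diff_exp]. On the right,
    x2^-1 delta((x1 - x0)/x2) = x1^-1 delta((x2 + x0)/x1) [delta_swap]; the
    factor x1^wt(u) becomes (x2 + x0)^wt(u) under the delta function, at the
    price of replacing delta by delta_rel(u), which is harmless because 2 wt(u)
    is an integer. Finally (x2 + x0)^wt(u) x2^wt(v) turns Y(Y(u, x0)v, x2) into
    X(Y[u, y]v, x2) for y = log(1 + x0/x2) [X_Yb_log, delta0_XY], since
    wt(u_m v) = wt(u) + wt(v) - m - 1. The last equation is [wt_mode]: L(0) acts
    on u_m v by the commutator formula, and in characteristic zero its
    eigenvalue determines the weight.

    For the second identity let a and b be homogeneous. The residue in x0 of the
    Jacobi identity gives, for the coefficients of x^s and x^t,
      [X_s(a), X_t(b)] = sum_n binom(wt(a) - s - 1, n) X_(s+t)(a_n b)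
    [commutator_X]. The right-hand side is X_(s+t) applied to
    Res_z (1 + z)^(wt(a) - s - 1) Y(a, z) b, and the substitution z = e^y - 1
    changes it into Res_y e^(-s y) Y[a, y] b [residue_expm1,
    commutator_expm1]. Summed against y1^s y2^t this is the delta function of
    the theorem. The coefficients a of Y[u1, x1] v1 are finite sums of
    homogeneous vectors whose weights agree modulo the integers, so that the
    formula extends to them by bilinearity; rel(u1) + rel(v1) records that class
    up to sign, and the sign does not matter for half-integers.

    Products with delta functions are computed by one lemma [fmul_delta_exp]:
    a coordinate in which the other factor has degree 0 singles out one summand
    of the delta function, whose expansion then contributes finitely many
    terms. *)

(** * Finite-support sums *)

Section FiniteSupportSums.
Variable M : zmodType.

Lemma fsum_seq (I : choiceType) (s : seq I) (f : I -> M) : uniq s ->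
    (forall i, i \notin s -> f i = 0) ->
  \sum_(i \in [set: I]) f i = \sum_(i <- s) f i.
Proof.
move=> us fs; rewrite (fsbigE s) // => [|i _ /fs //].
by apply: eq_bigl => i; apply: mem_set.
Qed.

Lemma fsum0 (I : choiceType) (f : I -> M) : (forall i, f i = 0) ->
  \sum_(i \in [set: I]) f i = 0.
Proof. by move=> f0; apply: fsbig1 => i _. Qed.

Lemma fsum1 (I : choiceType) (i0 : I) (f : I -> M) :
    (forall i, i != i0 -> f i = 0) ->
  \sum_(i \in [set: I]) f i = f i0.
Proof.
move=> f0; rewrite (@fsum_seq _ [:: i0]) ?big_seq1 // => i.
by rewrite inE; apply: f0.
Qed.

Lemma fsum_nat (N : nat) (f : nat -> M) : (forall k, (N <= k)%N -> f k = 0) ->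
  \sum_(k \in [set: nat]) f k = \sum_(k < N) f k.
Proof.
move=> f0; rewrite (@fsum_seq _ (iota 0 N)) ?iota_uniq //.
  by rewrite -[N in iota 0 N]subn0 big_mkord.
by move=> i; rewrite mem_iota leq0n add0n /= -leqNgt; apply: f0.
Qed.

Lemma fsum_inj (I : choiceType) (h : nat -> I) (f : I -> M) : injective h ->
    (forall i, f i <> 0 -> exists k, i = h k) ->
  \sum_(i \in [set: I]) f i = \sum_(k \in [set: nat]) f (h k).
Proof.
move=> hI fh.
have <- : \sum_(i \in range h) f i = \sum_(k \in [set: nat]) f (h k).
  by rewrite fsbig_image // => x y _ _ /hI.
apply/esym/fsbig_widen => // i [_ /= nih]; apply: contrapT => /fh [k ik].
by apply: nih; exists k.
Qed.

(** The Cauchy product of two truncated series: both sides run over the triangle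
    of pairs with i + j < N. *)
Lemma sum_antidiagonal (N : nat) (f : nat -> nat -> M) :
    (forall i j, (N <= i + j)%N -> f i j = 0) ->
  \sum_(i < N) \sum_(j < N) f i j = \sum_(n < N) \sum_(i < n.+1) f i (n - i)%N.
Proof.
move=> f0; transitivity (\sum_(i < N) \sum_(n < N | (i <= n)%N) f i (n - i)%N).
  apply: eq_bigr => i _.
  have -> : \sum_(j < N) f i j = \sum_(0 <= j < (N - i)%N) f i j.
    rewrite -(big_mkord xpredT (f i)) (big_cat_nat (n := (N - i)%N)) //=;
      last exact: leq_subr.
    rewrite [X in _ + X]big_nat_cond [X in _ + X]big1 ?addr0 // => j.
    by rewrite leq_subLR => /andP[/andP[+ _] _]; apply: f0.
  rewrite -(big_mkord (fun n => (i <= n)%N) (fun n => f i (n - i)%N)).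
  rewrite (eq_bigl (fun n => xpredT n && (i <= n)%N)) // -big_nat_widenl //.
  rewrite -[in RHS](add0n i).
  by rewrite big_addn; apply: eq_bigr => j _; rewrite addnK.
rewrite (exchange_big_dep xpredT) //=; apply: eq_bigr => n _.
rewrite -(big_mkord (fun i => (i <= n)%N) (fun i => f i (n - i)%N)).
rewrite -(big_mkord xpredT (fun i => f i (n - i)%N)).
by rewrite [RHS](big_nat_widen _ _ N) //; apply: eq_bigl => i; rewrite ltnS.
Qed.

End FiniteSupportSums.

(** * The ring of formal power series *)

(** A copy of nat -> F for the Cauchy product, as functions already form a ring
    under the pointwise product. *)
Definition pseries (F : fieldType) : Type := nat -> F.

Section PowerSeriesRing.
Variable F : fieldType.
Implicit Types f g h : pseries F.

Definition pstrunc (n : nat) f : {poly F} := \poly_(i < n) f i.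

(** Coefficients of products of series are coefficients of products of
    truncations, so that the ring laws are those of polynomials. *)
Lemma psmul_coef (p q : {poly F}) f g n :
    (forall i, (i <= n)%N -> p`_i = f i) ->
    (forall i, (i <= n)%N -> q`_i = g i) ->
  psmul f g n = (p * q)`_n.
Proof.
move=> pf qg; rewrite coefM; apply: eq_bigr => i _.
by rewrite pf ?qg ?leq_subr // -ltnS.
Qed.

Lemma pstrunc_coef n f i : (i < n)%N -> (pstrunc n f)`_i = f i.
Proof. by move=> lin; rewrite coef_poly lin. Qed.

Definition psconst (c : F) : pseries F := fun k => if k == 0%N then c else 0.
Definition psadd f g : pseries F := fun k => f k + g k.
Definition psopp f : pseries F := fun k => - f k.

HB.instance Definition _ := gen_eqMixin (pseries F).
HB.instance Definition _ := gen_choiceMixin (pseries F).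

Fact psaddA : associative psadd.
Proof. by move=> f g h; apply/funext => k; apply: addrA. Qed.
Fact psaddC : commutative psadd.
Proof. by move=> f g; apply/funext => k; apply: addrC. Qed.
Fact psadd0 : left_id (psconst 0) psadd.
Proof.
by move=> f; apply/funext => k; rewrite /psadd /psconst if_same add0r.
Qed.
Fact psaddN : left_inverse (psconst 0) psopp psadd.
Proof.
by move=> f; apply/funext => k; rewrite /psadd /psopp /psconst if_same addNr.
Qed.

HB.instance Definition _ :=
  GRing.isZmodule.Build (pseries F) psaddA psaddC psadd0 psaddN.

Fact psmulA : associative (@psmul F).
Proof.
move=> f g h; apply/funext => k; pose T := pstrunc k.+1.
have TE a i : (i <= k)%N -> (T a)`_i = a i by move=> ?; apply: pstrunc_coef.
have TM a b i : (i <= k)%N -> (T a * T b)`_i = psmul a b i.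
  by move=> ik; rewrite (@psmul_coef (T a) (T b)) // => j ji;
    apply/TE/(leq_trans ji).
rewrite (@psmul_coef (T f) (T g * T h)) => [|i /TE //|i /TM //].
rewrite (@psmul_coef (T f * T g) (T h)) ?mulrA // => i; last exact: TE.
exact: TM.
Qed.
Fact psmulC : commutative (@psmul F).
Proof.
move=> f g; apply/funext => k; have TE := @pstrunc_coef k.+1.
rewrite (@psmul_coef (pstrunc k.+1 f) (pstrunc k.+1 g)) //; try by move=> i /TE.
by rewrite mulrC -(@psmul_coef _ _ g f) // => i /TE.
Qed.
Fact psmul1 : left_id (psconst 1) (@psmul F).
Proof.
move=> f; apply/funext => k; rewrite /psmul big_ord_recl subn0 mul1r.
by rewrite big1 ?addr0 // => i _; rewrite mul0r.
Qed.
Fact psmulDl : left_distributive (@psmul F) psadd.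
Proof.
move=> f g h; apply/funext => k; rewrite /psadd -big_split /=.
by apply: eq_bigr => i _; rewrite mulrDl.
Qed.
Fact psone_neq0 : psconst 1 != psconst 0 :> pseries F.
Proof. by apply/eqP => /(congr1 (@^~ 0%N))/eqP; rewrite oner_eq0. Qed.

HB.instance Definition _ := GRing.Zmodule_isComNzRing.Build (pseries F)
  psmulA psmulC psmul1 psmulDl psone_neq0.

Lemma psDE f g k : (f + g) k = f k + g k. Proof. by []. Qed.
Lemma psNE f k : (- f) k = - f k. Proof. by []. Qed.
Lemma psME f g k : (f * g) k = psmul f g k. Proof. by []. Qed.
Definition psE := (psDE, psNE, psME).

Lemma ps0E k : (0 : pseries F) k = 0. Proof. exact: if_same. Qed.

Lemma ps1E k : (1 : pseries F) k = (k == 0%N)%:R.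
Proof. by case: k. Qed.

Lemma pssum_coef (I : Type) (s : seq I) (P : pred I) (f : I -> pseries F) k :
  (\sum_(i <- s | P i) f i) k = \sum_(i <- s | P i) f i k.
Proof. by elim/big_ind2: _ => // [|f1 a f2 b <- <-]; rewrite ?ps0E. Qed.

Lemma psconstM c f k : (psconst c * f) k = c * f k.
Proof.
rewrite psE /psmul big_ord_recl subn0 big1 ?addr0 // => i _.
by rewrite mul0r.
Qed.

Lemma psconst0 : psconst 0 = 0. Proof. by []. Qed.

Lemma psconstD c d : psconst (c + d) = psconst c + psconst d.
Proof. by apply/funext => -[|k]; rewrite !psE /psconst //= addr0. Qed.

Lemma psconstN c : psconst (- c) = - psconst c.
Proof. by apply/funext => -[|k]; rewrite psE /psconst //= oppr0. Qed.

Lemma psconst_mul c d : psconst (c * d) = psconst c * psconst d.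
Proof.
by apply/funext => k; rewrite psconstM /psconst; case: eqP; rewrite ?mulr0.
Qed.

Lemma psmul0 f g : (f * g) 0%N = f 0%N * g 0%N.
Proof. by rewrite psE /psmul big_ord1. Qed.

Lemma pstM0 f : ((pst : pseries F) * f) 0%N = 0.
Proof. by rewrite psmul0 mul0r. Qed.

Lemma pstM f k : ((pst : pseries F) * f) k.+1 = f k.
Proof.
rewrite psE /psmul !big_ord_recl /= mul0r add0r mul1r subSS subn0.
by rewrite big1 ?addr0 // => i _; rewrite mul0r.
Qed.

(** * Derivative *)

Definition psderiv f : pseries F := fun k => k.+1%:R * f k.+1.

Lemma psderivD f g : psderiv (f + g) = psderiv f + psderiv g.
Proof. by apply/funext => k; rewrite !psE /psderiv psE mulrDr. Qed.

Lemma psderiv_const c : psderiv (psconst c) = 0.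
Proof. by apply/funext => k; rewrite ps0E /psderiv mulr0. Qed.

Lemma psderiv_pst : psderiv pst = 1.
Proof.
by apply/funext => -[|k]; rewrite ps1E /psderiv /pst /= ?mulr0 // mulr1.
Qed.

Lemma psderivM f g : psderiv (f * g) = psderiv f * g + f * psderiv g.
Proof.
apply/funext => k; pose T := pstrunc k.+2; rewrite !psE /psderiv psE.
have TE a i : (i <= k.+1)%N -> (T a)`_i = a i by move=> ?; apply: pstrunc_coef.
have DE a i : (i <= k)%N -> (T a)^`()`_i = psderiv a i.
  by move=> ik; rewrite coef_deriv TE // -mulr_natl.
have TE' a i : (i <= k)%N -> (T a)`_i = a i by move=> ik; apply: TE; apply: leqW.
rewrite (@psmul_coef (T f) (T g)); try by move=> i /TE.
rewrite mulr_natl -coef_deriv derivM coefD.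
by rewrite (@psmul_coef (T f)^`() (T g)) ?(@psmul_coef (T f) (T g)^`()) //
  => i; first [exact: DE | exact: TE'].
Qed.

Lemma psderiv_constM c f : psderiv (psconst c * f) = psconst c * psderiv f.
Proof. by rewrite psderivM psderiv_const mul0r add0r. Qed.

Lemma psderivX g n : psderiv (g ^+ n) = psconst n%:R * g ^+ n.-1 * psderiv g.
Proof.
have nat1 m : psconst m.+1%:R = psconst m%:R + 1 by rewrite -addn1 natrD psconstD.
elim: n => [|n IH]; first by rewrite expr0 (psderiv_const 1) !mul0r.
rewrite exprS psderivM {}IH nat1 /=; case: n => [|n] /=.
  by rewrite expr0 !psconst0; ring.
by rewrite exprS; ring.
Qed.

Lemma psderiv_sum (I : Type) (s : seq I) (f : I -> pseries F) :
  psderiv (\sum_(i <- s) f i) = \sum_(i <- s) psderiv (f i).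
Proof.
elim/big_rec2: _ => [|i a b _ <-]; first exact: (psderiv_const 0).
by rewrite psderivD.
Qed.

End PowerSeriesRing.

(** * Composition *)

Section Composition.
Variable F : fieldType.
Local Notation comp a g := (pscomp a g : pseries F).
Implicit Types a b f g : pseries F.

Lemma pstruncX n g k i : (i < n)%N -> (pstrunc n g ^+ k)`_i = (g ^+ k) i.
Proof.
elim: k i => [|k IH] i lin.
  by rewrite !expr0 coef1 ps1E; case: (i == 0%N).
rewrite !exprS psE (@psmul_coef _ (pstrunc n g) (pstrunc n g ^+ k)) // => j ji.
  by rewrite pstrunc_coef // (leq_ltn_trans ji).
by rewrite IH // (leq_ltn_trans ji).
Qed.

Variables (g : pseries F) (g0 : g 0%N = 0).

Lemma psX_small k i : (i < k)%N -> (g ^+ k) i = 0.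
Proof.
elim: k i => [//|k IH] i lik; rewrite exprS psE /psmul big1 // => -[[|j] lj] _.
  by rewrite g0 mul0r.
rewrite IH ?mulr0 //=; case: i lj lik => // i _; rewrite subSS => lik.
exact: leq_ltn_trans (leq_subr _ _) _.
Qed.

(** A single truncation level N serves all the coefficients below it, because
    g has no constant term. *)
Lemma pscomp_coef a N m : (m < N)%N ->
  pscomp a g m = \sum_(k < N) a k * (g ^+ k) m.
Proof.
move=> mN; rewrite /pscomp coef_sum.
have H k : (m < k)%N -> a k * (g ^+ k) m = 0.
  by move=> mk; rewrite psX_small ?mulr0.
rewrite -(big_mkord xpredT (fun k => a k * (g ^+ k) m)).
rewrite (big_cat_nat (n := m.+1)) //= [X in _ = _ + X]big_nat_cond.
rewrite [X in _ = _ + X]big1 ?addr0; last by move=> k /andP[/andP[/H]].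
by rewrite big_mkord; apply: eq_bigr => k _; rewrite coefZ pstruncX.
Qed.

Lemma pscomp_trunc a N m : (m < N)%N ->
  pscomp a g m = (\sum_(k < N) psconst (a k) * g ^+ k) m.
Proof.
move=> mN; rewrite pssum_coef (pscomp_coef _ mN).
by apply: eq_bigr => k _; rewrite psconstM.
Qed.

Lemma pscomp0 a : pscomp a g 0%N = a 0%N.
Proof. by rewrite (@pscomp_coef _ 1) // big_ord1 expr0 mulr1. Qed.

Lemma pscomp1 : pscomp (1 : pseries F) g = 1 :> pseries F.
Proof.
apply/funext => m; rewrite (@pscomp_coef _ m.+1) // big_ord_recl expr0.
by rewrite !ps1E mul1r big1 ?addr0 // => k _; rewrite ps1E mul0r.
Qed.

Lemma pscompD a b : pscomp (a + b : pseries F) g = comp a g + comp b g.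
Proof.
apply/funext => m; rewrite psE !(@pscomp_coef _ m.+1) // -big_split.
by apply: eq_bigr => k _; rewrite psE mulrDl.
Qed.

Lemma pscomp_constM c a :
  pscomp (psconst c * a : pseries F) g = psconst c * comp a g.
Proof.
apply/funext => m; rewrite psconstM !(@pscomp_coef _ m.+1) // mulr_sumr.
by apply: eq_bigr => k _; rewrite psconstM mulrA.
Qed.

Lemma pscomp_pst : pscomp pst g = g.
Proof.
apply/funext => m; rewrite (@pscomp_coef _ m.+2) // !big_ord_recl expr1.
have pE i : (pst i : F) = (i == 1%N)%:R by [].
by rewrite !pE mul0r add0r mul1r big1 ?addr0 // => k _; rewrite pE mul0r.
Qed.

Lemma pscompM a b : pscomp (a * b : pseries F) g = comp a g * comp b g.
Proof.
apply/funext => m; set N := m.+1.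
have -> : (comp a g * comp b g) m =
   ((\sum_(k < N) psconst (a k) * g ^+ k)
    * (\sum_(k < N) psconst (b k) * g ^+ k)) m.
  rewrite !psE /psmul; apply: eq_bigr => i _.
  by rewrite -!pscomp_trunc // /N ltnS leq_subr.
rewrite (@pscomp_coef _ N) // mulr_suml pssum_coef.
under [RHS]eq_bigr => i _ do rewrite mulr_sumr pssum_coef.
rewrite [RHS](sum_antidiagonal (f := fun i j =>
  (psconst (a i) * g ^+ i * (psconst (b j) * g ^+ j)) m)).
  apply: eq_bigr => n _; rewrite psE mulr_suml; apply: eq_bigr => i _.
  by rewrite mulrACA -psconst_mul -exprD subnKC ?psconstM // -ltnS.
move=> i j mij; rewrite mulrACA -psconst_mul -exprD psconstM psX_small ?mulr0 //.
Qed.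

Lemma psderiv_comp a :
  psderiv (pscomp a g) = comp (psderiv a) g * psderiv g.
Proof.
apply/funext => m; set N := m.+2.
have -> : psderiv (pscomp a g) m =
    psderiv (\sum_(k < N) psconst (a k) * g ^+ k) m.
  by rewrite /psderiv -pscomp_trunc.
rewrite psderiv_sum big_ord_recl.
rewrite expr0 mulr1 psderiv_const add0r.
under eq_bigr => i _ do rewrite psderiv_constM psderivX mulrA mulrA -psconst_mul.
rewrite -mulr_suml !psE /psmul; apply: eq_bigr => i _; congr (_ * _).
rewrite (@pscomp_coef _ m.+1) // pssum_coef; apply: eq_bigr => k _.
by rewrite psconstM /psderiv mulrC [_ * a _]mulrC mulrC.
Qed.

End Composition.

(** * Exponential, binomial and logarithm series *)

Section CharacteristicZero.
Variables (F : fieldType) (char0 : [pchar F] =i pred0).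
Implicit Types f g : pseries F.

Local Notation pvar := (pst : pseries F).
Local Notation pow s h := (pspow s h : pseries F).

Lemma natS_neq0 n : n.+1%:R != 0 :> F.
Proof. by rewrite ((pcharf0P F).1 char0). Qed.

Lemma nat1D_neq0 n : 1 + n%:R != 0 :> F.
Proof. by rewrite nat1r natS_neq0. Qed.

Lemma fact_neq0 n : n`!%:R != 0 :> F.
Proof. by rewrite ((pcharf0P F).1 char0) -lt0n fact_gt0. Qed.

(** In characteristic zero the equation f' = q f determines the coefficients
    of f one after the other. *)
Lemma ode_unique q f g : psderiv f = q * f -> psderiv g = q * g ->
  f 0%N = g 0%N -> f = g.
Proof.
move=> Df Dg fg0; apply/funext => k.
have [n] := ubnP k; elim: n k => // n IH [|k] // lkn.
apply: (mulfI (natS_neq0 k)); rewrite -!/(psderiv _ k) Df Dg !psE.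
by apply: eq_bigr => i _; rewrite IH // (leq_ltn_trans (leq_subr _ _)).
Qed.

Definition expseries (s : F) : pseries F := fun k => s ^+ k / k`!%:R.

Lemma psderiv_exp s : psderiv (expseries s) = psconst s * expseries s.
Proof.
apply/funext => k; rewrite psconstM /psderiv /expseries factS natrM exprS.
by field; rewrite fact_neq0 nat1D_neq0.
Qed.

Lemma expseries0 s : expseries s 0%N = 1.
Proof. by rewrite /expseries expr0 divr1. Qed.

Lemma expseriesD s r : expseries (s + r) = expseries s * expseries r.
Proof.
apply: (ode_unique (psderiv_exp _)); last first.
  by rewrite psmul0 !expseries0 mulr1.
by rewrite psderivM !psderiv_exp psconstD; ring.
Qed.

Lemma psexpE s g : psexp s g = pscomp (expseries s) g. Proof. by []. Qed.

Lemma psexp0 s g : g 0%N = 0 -> psexp s g 0%N = 1.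
Proof. by move=> g0; rewrite psexpE pscomp0 // expseries0. Qed.

Lemma psexpD s r g : g 0%N = 0 ->
  psexp (s + r) g = psmul (psexp s g) (psexp r g).
Proof. by move=> g0; rewrite !psexpE expseriesD pscompM. Qed.

Lemma pscomp_var f : pscomp f pst = f.
Proof.
apply/funext => m; rewrite (@pscomp_coef _ _ _ _ m.+1) //.
have pstX k : (pvar ^+ k) = fun i => (i == k)%:R.
  elim: k => [|k IH]; apply/funext => i.
    by rewrite expr0 ps1E; case: i.
  by rewrite exprS IH; case: i => [|i]; rewrite ?pstM0 ?pstM.
rewrite (bigD1 ord_max) //= pstX eqxx mulr1 big1 ?addr0 // => k km.
rewrite pstX; case: eqP => [mk|_]; last by rewrite mulr0.
by case/eqP: km; apply: val_inj.
Qed.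

Lemma psexp_var s : psexp s pst = expseries s.
Proof. by rewrite psexpE pscomp_var. Qed.

Lemma gbinom0 (s : F) : gbinom s 0 = 1.
Proof. by rewrite /gbinom big_ord0 divr1. Qed.

Lemma gbinomS (s : F) k : k.+1%:R * gbinom s k.+1 = (s - k%:R) * gbinom s k.
Proof.
rewrite /gbinom big_ord_recr factS natrM /=.
by field; rewrite fact_neq0 nat1D_neq0.
Qed.

Lemma gbinomSl (s : F) k : k.+1%:R * gbinom s k.+1 = s * gbinom (s - 1) k.
Proof.
rewrite /gbinom big_ord_recl factS natrM /= subr0.
have -> : \prod_(i < k) (s - (bump 0 i)%:R) = \prod_(i < k) (s - 1 - i%:R).
  by apply: eq_bigr => i _; rewrite /bump add1n -addn1 natrD; ring.
by field; rewrite fact_neq0 nat1D_neq0.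
Qed.

Lemma gbinom_negate (s : F) k :
  (-1) ^+ k * gbinom s k = gbinom (k%:R - 1 - s) k.
Proof.
rewrite /gbinom mulrA; congr (_ / _).
rewrite -[k in (-1) ^+ k]card_ord -prodr_const -big_split /=.
rewrite (reindex_inj rev_ord_inj) /=; apply: eq_bigr => i _.
by rewrite natrB // -addn1 natrD; ring.
Qed.

Lemma psderiv_gbinom (s : F) :
  psderiv (gbinom s) = psconst s * (gbinom (s - 1) : pseries F).
Proof. by apply/funext => k; rewrite psconstM -gbinomSl. Qed.

Lemma gbinom_pascal (s : F) :
  gbinom (s + 1) = (1 + pvar) * (gbinom s : pseries F) :> pseries F.
Proof.
apply/funext => -[|k].
  by rewrite psmul0 psE ps1E !gbinom0 mulr1 /pst addr0.
rewrite mulrDl psE mul1r pstM; apply: (mulfI (natS_neq0 k)).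
by rewrite gbinomSl addrK mulrDr gbinomS; ring.
Qed.

Lemma psderiv_log1p (c : F) :
  psderiv (pslog1p c) = fun k => c * (- c) ^+ k.
Proof.
apply/funext => k; rewrite /psderiv /pslog1p /= exprS.
by field; rewrite nat1D_neq0.
Qed.

(** e^(s log(1 + c t)) = (1 + c t)^s: both sides solve f' = s c (1 + c t)^-1 f. *)
Lemma psexp_log1p (s c : F) k : psexp s (pslog1p c) k = gbinom s k * c ^+ k.
Proof.
pose B : pseries F := fun k => gbinom s k * c ^+ k.
rewrite -[RHS]/(B k); congr (_ k).
apply: (@ode_unique (psconst s * psderiv (pslog1p c))).
- rewrite psexpE psderiv_comp // psderiv_exp pscomp_constM //; ring.
- pose w : pseries F := fun k => (- c) ^+ k.
  have wP : w * (1 + psconst c * pvar) = 1.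
    apply/funext => -[|j].
      by rewrite psmul0 psE ps1E psconstM /pst mulr0 addr0 mulr1.
    rewrite mulrDr mulr1 mulrCA [w * _]mulrC psE psconstM pstM.
    by rewrite /w exprS ps1E mulNr addNr.
  have BS j : psderiv B j = (s - j%:R) * gbinom s j * c ^+ j.+1.
    by rewrite /psderiv /B mulrA gbinomS.
  have DB : (1 + psconst c * pvar) * psderiv B = psconst (s * c) * B.
    apply/funext => -[|j]; rewrite psconstM mulrDl mul1r -mulrA psE psconstM.
      by rewrite pstM0 mulr0 addr0 BS /B gbinom0; ring.
    have gS : gbinom s j.+1 * j.+1%:R = (s - j%:R) * gbinom s j.
      by rewrite mulrC gbinomS.
    by rewrite pstM !BS -gS /B exprS; ring.
  have -> : psderiv (pslog1p c) = psconst c * w.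
    by rewrite psderiv_log1p; apply/funext => j; rewrite psconstM.
  rewrite mulrA -psconst_mul mulrAC -DB mulrAC [_ * w]mulrC wP; ring.
- by rewrite psexp0 // /B gbinom0 mulr1.
Qed.

Section Power.
Variables (h : pseries F) (h0 : h 0%N = 1).

Let hs : pseries F := fun k => if k == 0%N then 0 else h k.

Let hsE : h = 1 + hs.
Proof.
by apply/funext => -[|k]; rewrite psE ps1E /= ?h0 ?addr0 // add0r.
Qed.

Lemma pspow0 (s : F) : pspow s h 0%N = 1.
Proof. by rewrite /pspow pscomp0 // gbinom0. Qed.

Lemma pspowS (s : F) : pspow (s + 1) h = h * pow s h.
Proof.
rewrite /pspow gbinom_pascal -/hs pscompM // pscompD // pscomp1 //.
by rewrite pscomp_pst // -hsE.
Qed.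

Lemma psderiv_pow (s : F) :
  psderiv (pspow s h) = psconst s * psderiv h * pow (s - 1) h.
Proof.
rewrite /pspow -/hs psderiv_comp // psderiv_gbinom pscomp_constM //.
by rewrite [in RHS]hsE psderivD (psderiv_const 1) add0r; ring.
Qed.

End Power.

Lemma pspow1 (s : F) : pspow s (1 : pseries F) = (1 : pseries F).
Proof.
rewrite /pspow; set g := fun _ => _.
have -> : g = 0 :> pseries F.
  by apply/funext => -[|k]; rewrite /g ps0E //= ps1E.
apply/funext => m; rewrite (@pscomp_coef _ _ _ _ m.+1) //.
rewrite big_ord_recl expr0 gbinom0 mul1r big1 ?addr0 // => k _.
by rewrite expr0n /= mulr0n ps0E mulr0.
Qed.

(** (e^t - 1) / t *)
Definition expm1_quot : pseries F := fun i => psexp 1 pst i.+1.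

(** Res_t e^(ct) (e^t - 1)^(-m-1) = Res_z (1+z)^(c-1) z^(-m-1). The substitution
    z = e^t - 1 is replaced by induction on m: the derivative of
    e^(ct) (e^t - 1)^(-m) has no residue, which gives
    c Res e^(ct) (e^t - 1)^(-m) = m Res e^((c+1)t) (e^t - 1)^(-m-1). *)
Lemma residue_expm1 (c : F) m :
  psmul (psexp c pst) (pspow (- m.+1%:R) expm1_quot) m = gbinom (c - 1) m.
Proof.
have h0 : expm1_quot 0%N = 1.
  by rewrite /expm1_quot psexp_var /expseries expr1n divr1.
have tP f k : (pvar * psderiv f) k = k%:R * f k.
  by case: k => [|k]; rewrite ?pstM0 ?mul0r // pstM.
have E1 : expseries 1 = 1 + pvar * expm1_quot.
  apply/funext => -[|k]; rewrite psE.
    by rewrite pstM0 expseries0 ps1E addr0.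
  by rewrite pstM /expm1_quot psexp_var ps1E add0r.
have Dh : pvar * psderiv expm1_quot = expseries 1 - expm1_quot.
  have := psderiv_exp 1; rewrite [in LHS]E1 psderivD (psderiv_const 1) psderivM.
  by rewrite psderiv_pst !mul1r add0r => <-; ring.
elim: m c => [|m IH] c.
  by rewrite /psmul big_ord1 psexp_var expseries0 pspow0 mulr1 gbinom0.
pose f : pseries F := expseries (c - 1) * pow (- m.+1%:R) expm1_quot.
have mN : - m.+1%:R - 1 = - m.+2%:R :> F by rewrite -[m.+2]addn1 natrD; ring.
have key : pvar * psderiv f = psconst (c - 1) * (pvar * f)
    + psconst m.+1%:R * f
    - psconst m.+1%:R * (expseries c * pow (- m.+2%:R) expm1_quot).
  rewrite psderivM psderiv_exp psderiv_pow // mN.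
  have -> : expseries c = expseries (c - 1) * expseries 1.
    by rewrite -expseriesD subrK.
  have P1 : pspow (- m.+1%:R) expm1_quot
       = expm1_quot * pow (- m.+2%:R) expm1_quot :> pseries F.
    by rewrite -mN -pspowS // subrK.
  rewrite psconstN.
  rewrite /f [in RHS]P1 [in LHS]P1.
  set P := pow (- m.+2%:R) expm1_quot; set E := expseries (c - 1).
  transitivity (psconst (c - 1) * pvar * E * (expm1_quot * P)
    - psconst m.+1%:R * (pvar * psderiv expm1_quot) * E * P); first by ring.
  by rewrite Dh; ring.
have E := congr1 (@^~ m.+1) key.
rewrite tP !(psDE, psNE) !psconstM pstM in E.
apply: (mulfI (natS_neq0 m)); rewrite gbinomSl -IH psexp_var -psME.
set C := (X in _ * X = _); set B := psmul _ _ _.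
rewrite -[m.+1%:R * C](subKr ((c - 1) * B + m.+1%:R * f m.+1)).
by rewrite /B psexp_var -E addrK.
Qed.

End CharacteristicZero.

(** * Rational exponents in a field of characteristic zero *)

Section RationalScalars.
Variables (F : fieldType) (char0 : [pchar F] =i pred0).

Lemma intr_neq0 (z : int) : z != 0 -> z%:~R != 0 :> F.
Proof.
by case: z => [[|n]|n] // _; rewrite ?NegzE ?rmorphN ?oppr_eq0 /= natS_neq0.
Qed.

(** In characteristic zero no denominator vanishes in F, so that any fraction, in
    lowest terms or not, may be used to embed a rational number. *)
Lemma ratr_frac (p q : int) : q != 0 ->
  ratr (p%:~R / q%:~R) = p%:~R / q%:~R :> F.
Proof.
move=> q0; rewrite /ratr; set r : rat := p%:~R / q%:~R.
have q0r : q%:~R != 0 :> rat by rewrite intr_eq0.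
have E : numq r * q = p * denq r.
  apply: (@intr_inj rat); rewrite !intrM.
  have <- : r * (denq r)%:~R = (numq r)%:~R by rewrite -numqE.
  by rewrite /r mulrAC divfK // mulrC.
have d0 := intr_neq0 (denq_neq0 r); have qF := intr_neq0 q0.
by apply/eqP; rewrite eqr_div // -!intrM E.
Qed.

Lemma ratrD a b : ratr (a + b) = ratr a + ratr b :> F.
Proof.
have da := denq_neq0 a; have db := denq_neq0 b.
have -> : a + b = (numq a * denq b + numq b * denq a)%:~R
    / (denq a * denq b)%:~R.
  rewrite -[in LHS](divq_num_den a) -[in LHS](divq_num_den b).
  rewrite addf_div ?intr_eq0 //.
  by rewrite intrD !intrM.
rewrite ratr_frac ?mulf_neq0 // /ratr addf_div ?intr_neq0 //.
by rewrite intrD !intrM.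
Qed.

Lemma ratr_intD (z : int) a : ratr (z%:~R + a) = z%:~R + ratr a :> F.
Proof. by rewrite ratrD ratr_int. Qed.

Lemma ratr_eq0 a : (ratr a == 0 :> F) = (a == 0).
Proof.
apply/idP/idP => [|/eqP->]; last by rewrite (ratr_int F 0).
rewrite /ratr mulf_eq0 invr_eq0 (negbTE (intr_neq0 (denq_neq0 a))) orbF.
by apply: contraTT; rewrite -numq_eq0; apply: intr_neq0.
Qed.

Lemma ratrN a : ratr (- a) = - ratr a :> F.
Proof. by apply/eqP; rewrite -addr_eq0 -ratrD addNr ratr_eq0. Qed.

End RationalScalars.

Lemma floorB_nat (c : rat) (k : nat) : c - k%:R \is a Num.int ->
  Num.floor (c - k%:R) = Num.floor c - k%:Z.
Proof.
move=> ck; have ci : c \is a Num.int by rewrite -[c](subrK k%:R) rpredD ?natr_int.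
by rewrite -[in LHS](floorK ci) -[k%:R]/(k%:Z%:~R) -intrB intrKfloor.
Qed.

(** * Delta functions *)

Lemma scale_nat_inj n (nu : 'rV[rat]_n) (v : 'rV[rat]_n) : nu != 0 ->
  injective (fun k : nat => v + k%:R *: nu).
Proof.
move=> nu0 k l /addrI /eqP; rewrite -subr_eq0 -scalerBl scaler_eq0 (negbTE nu0).
by rewrite orbF subr_eq0 eqr_nat => /eqP.
Qed.

Section DeltaSeries.
Variables (F : fieldType) (char0 : [pchar F] =i pred0) (n : nat).
Implicit Types (nu mu sh a b d e : 'rV[rat]_n) (f y : nat -> F).

Lemma pssubst_coef nu f k : nu != 0 -> pssubst nu f (k%:R *: nu) = f k.
Proof.
move=> nu0; rewrite /pssubst (fsum1 (i0 := k)).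
  by rewrite /fmono eqxx mulr1.
move=> l lk; rewrite /fmono -[k%:R *: nu]add0r -[l%:R *: nu]add0r.
rewrite (inj_eq (scale_nat_inj (v := 0) nu0)) eq_sym.
by rewrite (negbTE lk) mulr0.
Qed.

Lemma pssubst_out nu f e : (forall k, e <> k%:R *: nu) -> pssubst nu f e = 0.
Proof.
move=> ne; apply: fsum0 => k; rewrite /fmono.
by case: eqP => [/ne //|_]; rewrite mulr0.
Qed.

(** (x - y)^m = x^m e^(m log(1 - y/x)), one summand at a time. *)
Lemma delta_diff_exp (c : F) a b d :
  delta_diff c a b d = delta_exp 0 c (pslog1p (- 1)) (b - a) (a - d).
Proof.
apply/funext => e; apply: eq_fsbigr => m _; congr (_ * _).
rewrite /fshift /binom_expansion /pssubst; apply: eq_fsbigr => k _.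
have -> : ratr 0 = 0 :> F by rewrite (ratr_int F 0).
rewrite !addr0 psexp_log1p // [_ * gbinom _ _]mulrC; congr (_ * _).
rewrite /fmono -subr_eq0 -[in RHS]subr_eq0; congr (_ (_ == 0))%:R.
by apply/rowP => i; rewrite !mxE; ring.
Qed.

Section Coordinate.
Variables (i : 'I_n) (nu mu : 'rV[rat]_n).
Hypotheses (nu_i : nu 0 i = 0) (mu_i : mu 0 i = -1) (nu0 : nu != 0).

(** The coordinate i of an exponent of delta_r(c e^y z^mu) selects the only
    summand in which this exponent can occur. *)
Lemma delta_expE (r : rat) (c : F) y d (q := - d 0 i) :
  delta_exp r c y nu mu d =
  if (q - r) \is a Num.int then
    c ^ Num.floor (q - r) * pssubst nu (psexp (ratr q) y) (d - q *: mu)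
  else 0.
Proof.
pose P (m : int) :=
  pssubst nu (psexp (m%:~R + ratr r) y) (d - (m%:~R + r) *: mu).
have dq m : P m != 0 -> m%:~R + r = q.
  rewrite /P => nz.
  have [k dk] : exists k : nat, d - (m%:~R + r) *: mu = k%:R *: nu.
    by apply: contrapT => /forallNP ne; rewrite pssubst_out ?eqxx in nz.
  move/(congr1 (fun v : 'rV[rat]_n => v 0 i)): dk; rewrite !mxE nu_i mu_i mulr0.
  by rewrite mulrN1 opprK /q => /eqP; rewrite addrC addr_eq0 => /eqP.
rewrite /delta_exp /fshift; case: ifPn => qr; last first.
  apply: fsum0 => m; have [P0|/dq mq] := eqVneq (P m) 0.
    by rewrite -/(P m) P0 mulr0.
  by case/negP: qr; rewrite -mq addrK intr_int.
have qE : (Num.floor (q - r))%:~R + r = q by rewrite floorK // subrK.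
rewrite (fsum1 (i0 := Num.floor (q - r))); first by rewrite -ratr_intD // qE.
move=> m mN; have [P0|/dq mq] := eqVneq (P m) 0.
  by rewrite -/(P m) P0 mulr0.
by case/eqP: mN; rewrite -mq addrK intrKfloor.
Qed.

(** Only the summand m + r = q meets the support of G, and in it only the powers
    of z^nu below the bound N. *)
Section Product.
Variables (V : lmodType F) (G : fseries n V).
Hypothesis G_i : forall d, d 0 i != 0 -> G d = 0.
Variables (r : rat) (c : F) (y : nat -> F) (sh e : 'rV[rat]_n) (N : nat).
Let q := sh 0 i - e 0 i.
Let base := e - sh - q *: mu.
Hypothesis G_N : forall k, (N <= k)%N -> G (base - k%:R *: nu) = 0.

Let term d := fshift sh (delta_exp r c y nu mu) d *: G (e - d).

Let term_neq0 d : term d != 0 ->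
  exists2 k : nat, (k < N)%N & d = (sh + q *: mu) + k%:R *: nu.
Proof.
rewrite /term scaler_eq0 negb_or /fshift => /andP[dn0 Gn0].
have di : d 0 i = e 0 i.
  have [/eqP|di] := eqVneq ((e - d) 0 i) 0; last by rewrite G_i ?eqxx in Gn0.
  by rewrite !mxE subr_eq0 => /eqP.
move: dn0; rewrite delta_expE; case: ifP => _; last by rewrite eqxx.
have -> : - (d - sh) 0 i = q by rewrite !mxE di opprB.
move=> sn0; have [k dk] : exists k : nat, d - sh - q *: mu = k%:R *: nu.
  apply: contrapT => /forallNP ne; rewrite pssubst_out ?mulr0 ?eqxx in sn0 => //.
exists k; last by rewrite -dk; apply/rowP => j; rewrite !mxE; ring.
rewrite ltnNge; apply: contra Gn0 => /G_N E.
rewrite -{}E -dk; apply/eqP; congr G.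
by apply/rowP => j; rewrite !mxE; ring.
Qed.

Lemma fmulable_delta_exp : finite_set [set d | term d != 0].
Proof.
apply: (sub_finite_set _ (finite_image
  (fun k : nat => (sh + q *: mu) + k%:R *: nu) (finite_II N))).
by move=> d /= /term_neq0[k kN ->]; exists k.
Qed.

Lemma fmul_delta_exp :
  fmul (fshift sh (delta_exp r c y nu mu)) G e =
  if (q - r) \is a Num.int then
    c ^ Num.floor (q - r) *:
      \sum_(k < N) psexp (ratr q) y k *: G (base - k%:R *: nu)
  else 0.
Proof.
pose h k : 'rV[rat]_n := (sh + q *: mu) + k%:R *: nu.
have hE k : term (h k) = (if (q - r) \is a Num.int then
    c ^ Num.floor (q - r) * psexp (ratr q) y k else 0) *: G (base - k%:R *: nu).
  rewrite /term /fshift delta_expE.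
  have -> : - (h k - sh) 0 i = q by rewrite /h !mxE nu_i mu_i; ring.
  congr (_ *: G _); last by apply/rowP => j; rewrite !mxE; ring.
  case: ifP => // _; congr (_ * _); rewrite -(pssubst_coef _ k nu0).
  by congr pssubst; apply/rowP => j; rewrite !mxE; ring.
rewrite /fmul (fsum_inj (h := h)); last first.
- by move=> d /eqP/term_neq0[k _ ->]; exists k.
- exact: scale_nat_inj.
rewrite (fsum_nat (N := N)); last first.
  by move=> k kN; rewrite -/(term _) hE G_N // scaler0.
under eq_bigr => k _ do rewrite -/(term _) hE.
case: ifP => _; last by apply: big1 => k _; rewrite scale0r.
by rewrite scaler_sumr; apply: eq_bigr => k _; rewrite scalerA.
Qed.

End Product.
End Coordinate.
End DeltaSeries.

Lemma row3P (T : Type) (u v : 'rV[T]_3) :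
  u 0 0 = v 0 0 -> u 0 1 = v 0 1 -> u 0 2 = v 0 2 -> u = v.
Proof.
move=> E0 E1 E2; apply/rowP => -[[|[|[|//]]] j3].
- by rewrite (_ : Ordinal j3 = 0) //; apply: val_inj.
- by rewrite (_ : Ordinal j3 = 1) //; apply: val_inj.
- by rewrite (_ : Ordinal j3 = 2) //; apply: val_inj.
Qed.

(** x2^-1 delta((x1 - x0) / x2) = x1^-1 delta((x2 + x0) / x1): on the exponents
    (k, m - k, - 1 - m), where both sides are supported, it is the reflection
    binom(m, k) (-1)^k = binom(k - 1 - m, k). *)
Lemma delta_swap (F : fieldType) (char0 : [pchar F] =i pred0)
    (x0 := zvar 0 : 'rV[rat]_3) (x1 := zvar 1 : 'rV[rat]_3)
    (x2 := zvar 2 : 'rV[rat]_3) :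
  fshift (- x2) (delta_diff 1 x1 x0 x2) =
  fshift (- x1) (delta_exp 0 1 (pslog1p 1) (x0 - x2) (x2 - x1)) :> fseries 3 F.
Proof.
apply/funext => d; rewrite delta_diff_exp // /fshift !opprK.
have nuP (j : 'I_3) : j != 0 -> x0 - zvar j != 0 :> 'rV[rat]_3.
  move=> j0; apply/eqP => /rowP/(_ 0); rewrite !mxE /= eq_sym (negbTE j0).
  by rewrite subr0 => /eqP; rewrite oner_eq0.
have n1 : (x0 - x1) 0 2 = 0 by rewrite !mxE.
have m1 : (x1 - x2) 0 2 = -1 by rewrite !mxE.
have n2 : (x0 - x2) 0 1 = 0 by rewrite !mxE.
have m2 : (x2 - x1) 0 1 = -1 by rewrite !mxE.
rewrite (delta_expE char0 n1 m1).
rewrite (delta_expE char0 n2 m2).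
rewrite !subr0 !exp1rz !mul1r.
have -> : (d + x2) 0 2 = d 0 2 + 1 by rewrite !mxE.
have -> : (d + x1) 0 1 = d 0 1 + 1 by rewrite !mxE.
set q1 := - _; set q2 := - (d 0 1 + 1).
have v1 k : (d + x2 - q1 *: (x1 - x2) = k%:R *: (x0 - x1)) <->
    d 0 0 = k%:R /\ d 0 1 + d 0 2 + 1 = - k%:R.
  split=> [/rowP E|[E0 E1]].
    by move: (E 0) (E 1); rewrite !mxE /= /q1 => E0 E1; split; lra.
  by apply: row3P; rewrite !mxE /= /q1; lra.
have v2 k : (d + x1 - q2 *: (x2 - x1) = k%:R *: (x0 - x2)) <->
    d 0 0 = k%:R /\ d 0 1 + d 0 2 + 1 = - k%:R.
  split=> [/rowP E|[E0 E1]].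
    by move: (E 0) (E 2); rewrite !mxE /= /q2 => E0 E2; split; lra.
  by apply: row3P; rewrite !mxE /= /q2; lra.
have [[k dk]|/forallNP ndk] :=
    pselect (exists k : nat, d 0 0 = k%:R /\ d 0 1 + d 0 2 + 1 = - k%:R).
- rewrite (v1 k).2 // (v2 k).2 // !pssubst_coef ?nuP //.
  have qE : q2 = (k%:Z - 1)%:~R - q1.
    by rewrite intrB /q1 /q2; move: dk.2; rewrite -pmulrn; lra.
  rewrite qE !psexp_log1p // [_ * (-1) ^+ _]mulrC gbinom_negate expr1n mulr1.
  by rewrite ratr_intD // ratrN // rpredBl ?intr_int // intrB -pmulrn.
- rewrite !pssubst_out ?if_same // => k; [move/v2 | move/v1]; exact: ndk.
Qed.

(** * Operator series *)

Section OperatorSeries.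
Variables (F : fieldType) (V : lmodType F) (n : nat).
Implicit Types (P Q : V -> rat -> V -> V) (a : fseries n V) (e : 'rV[rat]_n).

Lemma opextend_at P a (x : 'rV[rat]_n) e w s0 : (forall s w, P 0 s w = 0) ->
    (forall s, s != s0 -> a (e - s *: x) = 0) ->
  opextend P a x e w = P (a (e - s0 *: x)) s0 w.
Proof.
by move=> P0 a0; rewrite /opextend (fsum1 (i0 := s0)) // => s /a0 ->.
Qed.

Lemma opextend_coord P a (i : 'I_n) e w : (forall s w, P 0 s w = 0) ->
    (forall d : 'rV[rat]_n, d 0 i != 0 -> a d = 0) ->
  opextend P a (zvar i) e w = P (a (e - e 0 i *: zvar i)) (e 0 i) w.
Proof.
move=> P0 ai; apply: opextend_at => // s se.
by rewrite ai // !mxE !eqxx mulr1 subr_eq0 eq_sym.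
Qed.

Lemma fconst_coord (u : V) (i : 'I_n) (d : 'rV[rat]_n) :
  d 0 i != 0 -> fconst u d = 0.
Proof.
by move=> di; rewrite /fconst; case: eqP => // d0; rewrite d0 mxE eqxx in di.
Qed.

Lemma opextend_const P u (i : 'I_n) e w : (forall s w, P 0 s w = 0) ->
  opextend P (fconst u) (zvar i) e w =
  if e == e 0 i *: zvar i then P u (e 0 i) w else 0.
Proof.
move=> P0; rewrite opextend_coord //; last exact: fconst_coord.
by rewrite /fconst subr_eq0; case: ifP.
Qed.

Lemma opmul_const P Q u v (i j : 'I_n) e w : i != j ->
    (forall s w, P 0 s w = 0) -> (forall s w, Q 0 s w = 0) ->
    (forall s, P u s 0 = 0) ->
  opmul (opextend P (fconst u) (zvar i)) (opextend Q (fconst v) (zvar j)) e w =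
  if e == e 0 i *: zvar i + e 0 j *: zvar j then P u (e 0 i) (Q v (e 0 j) w)
  else 0.
Proof.
move=> ij P0 Q0 Pu0; rewrite /opmul (fsum1 (i0 := e 0 i *: zvar i)); last first.
  move=> d dN; rewrite !opextend_const //.
  case: (d =P _) => // dE; case: (e - d =P _) => [edE|_].
    2: by rewrite Pu0.
  case/eqP: dN; rewrite dE; congr (_ *: _).
  move/rowP/(_ i): edE; rewrite !mxE eqxx (negbTE ij) mulr0 => /eqP.
  by rewrite subr_eq0 => /eqP.
rewrite !opextend_const // !mxE !eqxx [j == i]eq_sym (negbTE ij) !mulr1 eqxx.
by rewrite mulr0 subr0 subr_eq addrC; case: ifP.
Qed.

End OperatorSeries.

Lemma span12 (e : 'rV[rat]_3) :
  (e == e 0 1 *: zvar 1 + e 0 2 *: zvar 2) = (e 0 0 == 0).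
Proof.
apply/eqP/eqP => [->|e0]; first by rewrite !mxE /=; ring.
by apply: row3P; rewrite !mxE /= ?e0; ring.
Qed.

Section Modes.
Variables (F : fieldType) (V : lmodType F) (md : int -> {bilinear V -> V -> V}).

Lemma Ycoef0l r w : Ycoef md 0 r w = 0.
Proof. by rewrite /Ycoef linear0l if_same. Qed.

Lemma Ycoef0r u r : Ycoef md u r 0 = 0.
Proof. by rewrite /Ycoef linear0r if_same. Qed.

Lemma Ycoef_int u (z : int) w : Ycoef md u z%:~R w = md (- z - 1) u w.
Proof. by rewrite /Ycoef intr_int intrKfloor. Qed.

Lemma Ycoef_mode u (m : int) w : Ycoef md u (- m - 1)%:~R w = md m u w.
Proof. by rewrite Ycoef_int opprB addrC addKr opprK. Qed.

Lemma YcoefDl u u' r w : Ycoef md (u + u') r w = Ycoef md u r w + Ycoef md u' r w.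
Proof. by rewrite /Ycoef; case: ifP; rewrite ?addr0 // linearDl. Qed.

Lemma YcoefDr u r w w' : Ycoef md u r (w + w') = Ycoef md u r w + Ycoef md u r w'.
Proof. by rewrite /Ycoef; case: ifP; rewrite ?addr0 // linearDr. Qed.

Lemma YcoefZl c u r w : Ycoef md (c *: u) r w = c *: Ycoef md u r w.
Proof. by rewrite /Ycoef; case: ifP; rewrite ?scaler0 // linearZl_LR. Qed.

Lemma Yser_iterate u v w (d : 'rV[rat]_3) :
  Yser md (Yser md (fconst u) (zvar 0) ^~ v) (zvar 2) d w =
  if d 0 1 == 0 then Ycoef md (Ycoef md u (d 0 0) v) (d 0 2) w else 0.
Proof.
rewrite /Yser opextend_coord; first last.
- move=> e e2; rewrite opextend_const; last exact: Ycoef0l.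
  by case: eqP => // /rowP/(_ 2) E; rewrite E !mxE mulr0 eqxx in e2.
- exact: Ycoef0l.
rewrite opextend_const; last exact: Ycoef0l.
rewrite !mxE /= mulr0 subr0; case: (d 0 1 =P 0) => [d1|d1].
  rewrite ifT //; apply/eqP; apply: row3P; rewrite !mxE /= ?d1; ring.
case: eqP => [/rowP/(_ 1)|_]; last exact: Ycoef0l.
by rewrite !mxE /= !mulr0 subr0 => /d1.
Qed.

End Modes.

(** * Modes of a vertex operator superalgebra *)

Section VertexModes.
Variables (F : fieldType) (char0 : [pchar F] =i pred0).
Variables (V : lmodType F) (A : vosa V).

Local Notation md := (mode A).
Local Notation Y := (Ycoef md).
Local Notation x0 := (zvar 0 : 'rV[rat]_3).
Local Notation x1 := (zvar 1 : 'rV[rat]_3).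
Local Notation x2 := (zvar 2 : 'rV[rat]_3).

Lemma mode_trunc_nat u v : exists M : nat, forall m : int, M%:Z <= m ->
  md m u v = 0.
Proof.
have [N HN] := mode_truncation A u v; exists `|N|%N => m Nm.
by apply: HN; apply: le_trans Nm; lia.
Qed.

Lemma Ycoef_trunc u v (c : rat) :
  exists M : nat, forall k : nat, (M <= k)%N -> Y u (c - k%:R) v = 0.
Proof.
have [M HM] := mode_trunc_nat u v.
exists (M + `|Num.floor c| + 1)%N => k Mk; rewrite /Ycoef; case: ifP => // ck.
by apply: HM; rewrite floorB_nat //; move: (Num.floor c) Mk => f Mk; lia.
Qed.

Lemma opmul_Y u v w (e : 'rV[rat]_3) :
  opmul (Yser md (fconst u) x1) (Yser md (fconst v) x2) e w =
  if e 0 0 == 0 then Y u (e 0 1) (Y v (e 0 2) w) else 0.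
Proof.
by rewrite /Yser opmul_const ?span12 // => *; rewrite ?Ycoef0l ?Ycoef0r.
Qed.

Lemma opmul_Y_rev u v w (e : 'rV[rat]_3) :
  opmul (Yser md (fconst v) x2) (Yser md (fconst u) x1) e w =
  if e 0 0 == 0 then Y v (e 0 2) (Y u (e 0 1) w) else 0.
Proof.
rewrite /Yser opmul_const // 1?addrC ?span12 // => *.
all: by rewrite ?Ycoef0l ?Ycoef0r.
Qed.

(** In logarithmic form the two delta functions on the left are those of the
    Jacobi identity. On the right the expansion changes from powers of x0/x1 to
    powers of x0/x2. *)
Lemma jacobi_exp (p q : bool) (u v w : V) e :
    parproj A p u = u -> parproj A q v = v ->
  fmul (fshift (- x0) (delta_exp 0 1 (pslog1p (- 1)) (x2 - x1) (x1 - x0)))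
    (opmul (Yser md (fconst u) x1) (Yser md (fconst v) x2) ^~ w) e
  - (-1) ^+ (p && q) *:
  fmul (fshift (- x0) (delta_exp 0 (- 1) (pslog1p (- 1)) (x1 - x2) (x2 - x0)))
    (opmul (Yser md (fconst v) x2) (Yser md (fconst u) x1) ^~ w) e
  = fmul (fshift (- x1) (delta_exp 0 1 (pslog1p 1) (x0 - x2) (x2 - x1)))
    (Yser md (Yser md (fconst u) x0 ^~ v) x2 ^~ w) e.
Proof.
move=> up vq; rewrite -!delta_diff_exp // -delta_swap //.
exact: (@jacobi _ _ A).
Qed.

(** The coordinates in which the three delta functions are evaluated by
    [fmul_delta_exp]: x0 on the left of the Jacobi identity, where the operator
    products are free of x0, and x1 on the right. *)
Lemma dir21 : (x2 - x1) 0 0 = 0 /\ (x1 - x0) 0 0 = -1 /\ x2 - x1 != 0.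
Proof.
split; [|split]; rewrite ?mxE //.
by apply/eqP => /rowP/(_ 2); rewrite !mxE /= subr0 => /eqP; rewrite oner_eq0.
Qed.
Lemma dir12 : (x1 - x2) 0 0 = 0 /\ (x2 - x0) 0 0 = -1 /\ x1 - x2 != 0.
Proof.
split; [|split]; rewrite ?mxE //.
by apply/eqP => /rowP/(_ 1); rewrite !mxE /= subr0 => /eqP; rewrite oner_eq0.
Qed.
Lemma dir02 : (x0 - x2) 0 1 = 0 /\ (x2 - x1) 0 1 = -1 /\ x0 - x2 != 0.
Proof.
split; [|split]; rewrite ?mxE //.
by apply/eqP => /rowP/(_ 0); rewrite !mxE /= subr0 => /eqP; rewrite oner_eq0.
Qed.

(** The residue in x0 of the Jacobi identity: in degree -1 in x0 the delta
    functions on the left reduce to the summand m = 0, which is 1. *)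
Lemma commutator_formula (p q : bool) (u v w : V) (s t : rat) N :
    parproj A p u = u -> parproj A q v = v ->
    (forall k, (N <= k)%N -> md k%:Z u v = 0) ->
  Y u s (Y v t w) - (-1) ^+ (p && q) *: Y v t (Y u s w) =
  if s \is a Num.int then
    \sum_(k < N) gbinom (ratr (- 1 - s)) k *: Y (md k%:Z u v) (s + t + k%:R + 1) w
  else 0.
Proof.
move=> up vq uvN.
pose e : 'rV[rat]_3 := - x0 + s *: x1 + t *: x2.
have q0 : (- x0) 0 0 - e 0 0 = 0 by rewrite !mxE /=; ring.
have psexp00 (c : F) k : psexp (ratr 0) (pslog1p c) k = (k == 0%N)%:R.
  rewrite psexp_log1p // (ratr_int F 0).
  case: k => [|k]; first by rewrite gbinom0 mulr1.
  by rewrite /gbinom big_ord_recl subrr !mul0r.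
have [n1 [m1 z1]] := dir21; have [n2 [m2 z2]] := dir12.
have [n3 [m3 z3]] := dir02.
have [M1 HM1] := Ycoef_trunc v w t; have [M2 HM2] := Ycoef_trunc u w s.
pose G1 : fseries 3 V :=
  opmul (Yser md (fconst u) x1) (Yser md (fconst v) x2) ^~ w.
pose G2 : fseries 3 V :=
  opmul (Yser md (fconst v) x2) (Yser md (fconst u) x1) ^~ w.
pose G3 : fseries 3 V := Yser md (Yser md (fconst u) x0 ^~ v) x2 ^~ w.
have G10 (d : 'rV[rat]_3) : d 0 0 != 0 -> G1 d = 0.
  by move=> d0; rewrite /G1 opmul_Y (negbTE d0).
have G20 (d : 'rV[rat]_3) : d 0 0 != 0 -> G2 d = 0.
  by move=> d0; rewrite /G2 opmul_Y_rev (negbTE d0).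
have G31 (d : 'rV[rat]_3) : d 0 1 != 0 -> G3 d = 0.
  by move=> d1; rewrite /G3 Yser_iterate (negbTE d1).
have G1N k : (M1.+1 <= k)%N ->
    G1 (e - - x0 - ((- x0) 0 0 - e 0 0) *: (x1 - x0) - k%:R *: (x2 - x1)) = 0.
  move=> Mk; rewrite /G1 opmul_Y; case: ifP => // _.
  rewrite [X in Y v X](_ : _ = t - k%:R) ?HM1 ?Ycoef0r //; first exact: ltnW.
  by rewrite q0 !mxE /=; ring.
have G2N k : (M2.+1 <= k)%N ->
    G2 (e - - x0 - ((- x0) 0 0 - e 0 0) *: (x2 - x0) - k%:R *: (x1 - x2)) = 0.
  move=> Mk; rewrite /G2 opmul_Y_rev; case: ifP => // _.
  rewrite [X in Y u X](_ : _ = s - k%:R) ?HM2 ?Ycoef0r //; first exact: ltnW.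
  by rewrite q0 !mxE /=; ring.
have G3N k : (N <= k)%N ->
    G3 (e - - x1 - ((- x1) 0 1 - e 0 1) *: (x2 - x1) - k%:R *: (x0 - x2)) = 0.
  move=> Nk; rewrite /G3 Yser_iterate; case: ifP => // _.
  rewrite [X in Y u X](_ : _ = (- k%:Z - 1)%:~R) ?Ycoef_mode ?uvN ?Ycoef0l //.
  by rewrite intrB intrN !mxE /= -!pmulrn; ring.
have first_term (c : F) M (f : nat -> V) :
    \sum_(k < M.+1) psexp (ratr 0) (pslog1p c) k *: f k = f 0%N.
  rewrite big_ord_recl psexp00 scale1r big1 ?addr0 // => k _.
  by rewrite psexp00 scale0r.
have ex0 : (e - - x0 - 0 *: (x1 - x0) - 0%:R *: (x2 - x1)) = s *: x1 + t *: x2.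
  by apply: row3P; rewrite !mxE /=; ring.
have ex0' : (e - - x0 - 0 *: (x2 - x0) - 0%:R *: (x1 - x2)) = s *: x1 + t *: x2.
  by apply: row3P; rewrite !mxE /=; ring.
have [c0 [c1 c2]] : (s *: x1 + t *: x2) 0 0 = 0 /\
    (s *: x1 + t *: x2) 0 1 = s /\ (s *: x1 + t *: x2) 0 2 = t.
  by rewrite !mxE /=; split; [|split]; ring.
have E1 := fmul_delta_exp char0 n1 m1 z1 G10 0 1 (pslog1p (- 1)) G1N.
rewrite q0 subrr rpred0 (intrKfloor 0) expr0z scale1r in E1.
rewrite (first_term _ _ (fun k => G1 (_ - k%:R *: _))) ex0 [RHS]opmul_Y in E1.
rewrite c0 c1 c2 eqxx in E1.
have E2 := fmul_delta_exp char0 n2 m2 z2 G20 0 (- 1) (pslog1p (- 1)) G2N.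
rewrite q0 subrr rpred0 (intrKfloor 0) expr0z scale1r in E2.
rewrite (first_term _ _ (fun k => G2 (_ - k%:R *: _))) ex0' in E2.
rewrite [RHS]opmul_Y_rev in E2.
rewrite c0 c1 c2 eqxx in E2.
have E3 := fmul_delta_exp char0 n3 m3 z3 G31 0 1 (pslog1p 1) G3N.
have qE : (- x1) 0 1 - e 0 1 = - 1 - s by rewrite !mxE /=; ring.
rewrite qE subr0 exp1rz scale1r rpredBl ?rpredN ?rpred1 // in E3.
have := etrans (esym (congr2 (fun a b => a - (-1) ^+ (p && q) *: b) E1 E2))
  (etrans (jacobi_exp w e up vq) E3).
move=> ->; case: ifP => // sint; apply: eq_bigr => k _.
rewrite psexp_log1p // expr1n mulr1 /G3 Yser_iterate.
rewrite [X in X == 0](_ : _ = 0) ?eqxx; last by rewrite !mxE /=; ring.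
rewrite [X in Y u X](_ : _ = (- k%:Z - 1)%:~R) ?Ycoef_mode; last first.
  by rewrite intrB intrN !mxE /= -!pmulrn; ring.
by congr (_ *: Y _ _ _); rewrite !mxE /=; ring.
Qed.

(** L(0) acts on u_m v by the commutator formula for the conformal vector:
    [L(0), u_m] = (L(-1) u)_(m+1) + (L(0) u)_m. *)
Lemma L0_mode (p : bool) (u v : V) (h k : rat) (m : int) :
    parproj A p u = u -> wtproj A h u = u -> wtproj A k v = v ->
  md 1 (conformal A) (md m u v) = ratr (h + k - m%:~R - 1) *: md m u v.
Proof.
move=> up uh vk; rename k into hv.
have [M HM] := mode_trunc_nat (conformal A) u.
have ocom := @commutator_formula false p (conformal A) u v (- 1 - 1)%:~R
  (- m - 1)%:~R M.+2 (conformal_parity A) up.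
have HM2 (k : nat) : (M.+2 <= k)%N -> md k%:Z (conformal A) u = 0.
  by move=> Mk; apply: HM; lia.
have {ocom HM2} := ocom HM2.
rewrite !Ycoef_mode intr_int (L0_weight vk) linearZr_LR /= expr0 scale1r.
rewrite !big_ord_recl big1 ?addr0; last first.
  move=> k _; rewrite (_ : gbinom _ _ = 0) ?scale0r // (_ : ratr _ = 1).
    by rewrite /gbinom !big_ord_recl /= subrr mul0r mulr0 mul0r.
  by rewrite (_ : _ - _ = 1%:~R) ?ratr_int // intrB /=; ring.
have e0 : (- 1 - 1)%:~R + (- m - 1)%:~R + 1 = (- (m + 1) - 1)%:~R :> rat.
  by rewrite !(intrB, intrD, intrN); ring.
have e1 : (- (m + 1) - 1)%:~R + 1 = (- m - 1)%:~R :> rat.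
  by rewrite !(intrB, intrD, intrN); ring.
rewrite e0.
rewrite e1 !Ycoef_mode Lm1_derivative (L0_weight uh) gbinom0 scale1r.
have -> : gbinom (ratr (- 1 - (- 1 - 1)%:~R)) 1 = 1 :> F.
  rewrite /gbinom big_ord1 subr0 divr1.
  by rewrite (_ : _ - _ = 1%:~R) ?ratr_int // intrB /=; ring.
rewrite scale1r linearZl_LR addrK => /eqP; rewrite subr_eq => /eqP ->.
have -> : h + hv - m%:~R - 1 = (- (m + 1))%:~R + (h + hv).
  by rewrite intrN intrD; ring.
by rewrite ratr_intD // ratrD // !scalerDl intrN scaleNr addrA.
Qed.

Lemma wt_support u :
  exists2 s : seq rat, uniq s & forall k, k \notin s -> wtproj A k u = 0.
Proof.
have /finite_seqP[s us] := wtproj_finite A u.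
exists (undup s); first exact: undup_uniq.
move=> k; rewrite mem_undup => /negP ks; apply/eqP/negPn/negP => nz.
by apply: ks; have : [set` s] k by rewrite -us.
Qed.

(** In characteristic zero distinct weights are distinct scalars, so that the
    eigenspaces of L(0) are the homogeneous components of V. *)
Lemma L0_eigen_weight (x : V) (h : rat) :
  md 1 (conformal A) x = ratr h *: x -> wtproj A h x = x.
Proof.
move=> Lx.
have [s us sx] := wt_support x.
have xE : x = \sum_(k <- s) wtproj A k x.
  by rewrite -(fsum_seq us) ?wtproj_sum.
have proj k : ratr k *: wtproj A k x = ratr h *: wtproj A k x.
  have [ks|/sx ->] := boolP (k \in s); last by rewrite !scaler0.
  rewrite -[RHS]linearZ -Lx [in RHS]xE (bigD1_seq k) //= !raddfD /=.
  rewrite (L0_weight (h := k)) ?wtprojM ?eqxx // linearZ /= wtprojM eqxx.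
  rewrite !raddf_sum big1 ?addr0 // => j jk.
  rewrite /= (L0_weight (h := j)) ?wtprojM ?eqxx // linearZ /= wtprojM eq_sym.
  by rewrite (negbTE jk) scaler0.
have xk k : k != h -> wtproj A k x = 0.
  move=> kh; have /eqP := proj k; rewrite -subr_eq0 -scalerBl scaler_eq0.
  by rewrite -ratrN // -ratrD // ratr_eq0 // subr_eq0 (negbTE kh) => /eqP.
by rewrite -[RHS](wtproj_sum A) (fsum1 (i0 := h)).
Qed.

Lemma wt_mode (p : bool) (u v : V) (h k : rat) (m : int) :
    parproj A p u = u -> wtproj A h u = u -> wtproj A k v = v ->
  wtproj A (h + k - m%:~R - 1) (md m u v) = md m u v.
Proof. by move=> up uh vk; apply/L0_eigen_weight/(L0_mode _ up). Qed.

(** * Homogeneous components *)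

Lemma wtproj_out h k u : wtproj A h u = u -> k != h -> wtproj A k u = 0.
Proof. by move=> <- kh; rewrite wtprojM (negbTE kh). Qed.

Lemma wtproj_par p h u : parproj A p u = u ->
  parproj A p (wtproj A h u) = wtproj A h u.
Proof. by rewrite parproj_wtproj => ->. Qed.

(** * The operators X(u, x) *)

Local Notation Xc := (Xcoef A).

Lemma Xcoef_seq (s : seq rat) u r w : uniq s ->
    (forall k, k \notin s -> wtproj A k u = 0) ->
  Xc u r w = \sum_(h <- s) Y (wtproj A h u) (r - h) w.
Proof. by move=> us su; apply: fsum_seq => // k /su->; rewrite Ycoef0l. Qed.

Lemma Xcoef_hom h u r w : wtproj A h u = u -> Xc u r w = Y u (r - h) w.
Proof.
move=> uh; rewrite (Xcoef_seq (s := [:: h])) ?big_seq1 ?uh // => k.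
by rewrite inE; apply: wtproj_out.
Qed.

Lemma XcoefDl u v r w : Xc (u + v) r w = Xc u r w + Xc v r w.
Proof.
have [s _ us] := wt_support u; have [t _ vt] := wt_support v.
have st k : k \notin undup (s ++ t) -> wtproj A k u = 0 /\ wtproj A k v = 0.
  by rewrite mem_undup mem_cat negb_or => /andP[/us-> /vt->].
rewrite !(Xcoef_seq (s := undup (s ++ t))) ?undup_uniq //;
  try by move=> k /st[uk vk]; rewrite ?raddfD /= ?uk ?vk ?addr0.
by rewrite -big_split; apply: eq_bigr => h _; rewrite raddfD YcoefDl.
Qed.

Lemma Xcoef0l r w : Xc 0 r w = 0.
Proof. by apply: fsum0 => h; rewrite raddf0 Ycoef0l. Qed.

Lemma XcoefZl c u r w : Xc (c *: u) r w = c *: Xc u r w.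
Proof.
have [s us su] := wt_support u; rewrite !(Xcoef_seq _ _ us) //.
  by rewrite scaler_sumr; apply: eq_bigr => h _; rewrite linearZ YcoefZl.
by move=> k /su uk; rewrite linearZ /= uk scaler0.
Qed.

Lemma Xcoef_suml (I : Type) (s : seq I) (f : I -> V) r w :
  Xc (\sum_(i <- s) f i) r w = \sum_(i <- s) Xc (f i) r w.
Proof.
elim: s => [|i s IH]; first by rewrite !big_nil Xcoef0l.
by rewrite !big_cons XcoefDl IH.
Qed.

Lemma XcoefDr u r w w' : Xc u r (w + w') = Xc u r w + Xc u r w'.
Proof.
have [s us su] := wt_support u; rewrite !(Xcoef_seq _ _ us) // -big_split.
by apply: eq_bigr => h _; apply: YcoefDr.
Qed.

Lemma Xcoef0r u r : Xc u r 0 = 0.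
Proof. by apply: fsum0 => h; apply: Ycoef0r. Qed.

Lemma Xcoef_par p q u r w : parproj A p u = u -> parproj A q w = w ->
  parproj A (p (+) q) (Xc u r w) = Xc u r w.
Proof.
move=> up wq; have [s us su] := wt_support u; rewrite !(Xcoef_seq _ _ us) //.
rewrite raddf_sum; apply: eq_bigr => h _; rewrite /Ycoef.
case: ifP => _; last by rewrite raddf0.
by apply: mode_parity => //; apply: wtproj_par.
Qed.

(** Since Y(u, x) with u of parity p shifts parities by p, only one of the four
    terms of the supercommutator of two such operators is nonzero. *)
Lemma endpar_Xcoef p q u r w : parproj A p u = u ->
  endpar A q (Xc u r) w = if q == p then Xc u r w else 0.
Proof.
move=> up; rewrite /endpar.
have E q' : parproj A (q (+) q') (Xc u r (parproj A q' w)) =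
    if q == p then Xc u r (parproj A q' w) else 0.
  have Xp := Xcoef_par r up (_ : parproj A q' (parproj A q' w) = parproj A q' w).
  rewrite -Xp; last by rewrite parprojM eqxx.
  rewrite parprojM Xp; last by rewrite parprojM eqxx.
  by congr (if _ then _ else _); case: q p q' {up Xp} => [] [] [].
under eq_bigr => q' _ do rewrite E.
case: (q == p); last by apply: big1.
by rewrite big_bool /= -XcoefDr addrC parproj_sum.
Qed.

Lemma supercomm_Xcoef p q a b s t w :
    parproj A p a = a -> parproj A q b = b ->
  supercomm A (Xc a s) (Xc b t) w =
  Xc a s (Xc b t w) - (-1) ^+ (p && q) *: Xc b t (Xc a s w).
Proof.
move=> ap bq.
have Ea p' w' : endpar A p' (Xc a s) w' = if p' == p then Xc a s w' else 0.
  exact: endpar_Xcoef.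
have Eb q' w' : endpar A q' (Xc b t) w' = if q' == q then Xc b t w' else 0.
  exact: endpar_Xcoef.
rewrite /supercomm (bigD1 p) //= (bigD1 q) //= !Ea !Eb !eqxx.
rewrite [X in _ + X + _]big1 => [|q' q'q]; last first.
  by rewrite !Ea !Eb (negbTE q'q) eqxx Xcoef0r scaler0 subr0.
rewrite big1 ?addr0 // => p' p'p; apply: big1 => q' _.
by rewrite !Ea !Eb (negbTE p'p); case: eqP; rewrite ?Xcoef0r scaler0 subr0.
Qed.

(** The commutator formula for X; the shifts of the exponents by the weights
    cancel on the right. *)
Lemma commutator_X (p q : bool) (a b w : V) (h k s t : rat) N :
    parproj A p a = a -> parproj A q b = b ->
    wtproj A h a = a -> wtproj A k b = b -> s - h \is a Num.int ->
    (forall n, (N <= n)%N -> md n%:Z a b = 0) ->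
  Xc a s (Xc b t w) - (-1) ^+ (p && q) *: Xc b t (Xc a s w) =
  \sum_(n < N) gbinom (ratr (h - s - 1)) n *: Xc (md n%:Z a b) (s + t) w.
Proof.
move=> ap bq ah bk shint abN; rewrite !(Xcoef_hom _ _ ah) !(Xcoef_hom _ _ bk).
rewrite (commutator_formula _ _ _ ap bq abN) shint; apply: eq_bigr => n _.
rewrite (_ : - 1 - (s - h) = h - s - 1); last by ring.
rewrite (Xcoef_hom _ _ (wt_mode _ ap ah bk)); congr (_ *: Y _ _ _).
by rewrite -pmulrn; ring.
Qed.

End VertexModes.

(** * The series Y[u, y] v *)

Section CylinderVertex.
Variables (F : fieldType) (char0 : [pchar F] =i pred0).
Variables (V : lmodType F) (A : vosa V).

Local Notation md := (mode A).
Local Notation Y := (Ycoef md).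
Local Notation Xc := (Xcoef A).

Lemma exp_laurentE (y : nat -> F) (s : F) (k : int) (j : nat) :
  exp_laurent y s (k - j%:Z) k =
  psmul (psexp s y) (pspow (k - j%:Z)%:~R (fun i => psexp 1 y i.+1)) j.
Proof. by rewrite /exp_laurent gerBl // subKr. Qed.

(** For y = log(1 + t) the series (e^y - 1) / t is 1. *)
Lemma exp_laurent_log (s : F) (k : int) (j : nat) :
  exp_laurent (pslog1p 1) s (k - j%:Z) k = psexp s (pslog1p 1) j.
Proof.
rewrite exp_laurentE; set h := fun i => psexp 1 _ _.
have -> : h = (1 : pseries F).
  apply/funext => i; rewrite /h psexp_log1p // expr1n mulr1 ps1E.
  case: i => [|i]; first by rewrite /gbinom big_ord1 subr0 divr1.
  by rewrite /gbinom !big_ord_recl /= subrr mul0r mulr0 mul0r.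
by rewrite pspow1 -psME mulr1.
Qed.

Lemma Ybcoef_seq (y : nat -> F) u v (k : int) (s : seq rat) (J : nat) :
    uniq s -> (forall h, h \notin s -> wtproj A h u = 0) ->
    (forall h j, (J <= j)%N -> md (j%:Z - k - 1) (wtproj A h u) v = 0) ->
  Ybcoef A y u v k = \sum_(h <- s) \sum_(j < J)
    exp_laurent y (ratr h) (k - j%:Z) k *: md (j%:Z - k - 1) (wtproj A h u) v.
Proof.
move=> us su uJ; rewrite /Ybcoef (fsum_seq us); last first.
  by move=> h /su ->; apply: fsum0 => m; rewrite linear0l scaler0.
apply: eq_bigr => h _; rewrite (fsum_inj (h := fun j : nat => j%:Z - k - 1)).
- rewrite (fsum_nat (N := J)); last by move=> j /uJ ->; rewrite scaler0.
  by apply: eq_bigr => j _; congr (exp_laurent _ _ _ _ *: _); ring.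
- by move=> i j /addIr/addIr [].
- move=> m; rewrite /exp_laurent; case: leP => [mk _|_]; last by rewrite scale0r.
  by exists (absz (m + k + 1)); move: (m : int) mk => l lk; lia.
Qed.

Lemma Ybcoef0l y v k : Ybcoef A y 0 v k = 0.
Proof.
by apply: fsum0 => h; apply: fsum0 => m; rewrite raddf0 linear0l scaler0.
Qed.

Lemma Ybcoef0r y u k : Ybcoef A y u 0 k = 0.
Proof. by apply: fsum0 => h; apply: fsum0 => m; rewrite linear0r scaler0. Qed.

Lemma Ybcoef_hom (y : nat -> F) u v (h : rat) (k : int) (J : nat) :
    wtproj A h u = u ->
    (forall j, (J <= j)%N -> md (j%:Z - k - 1) u v = 0) ->
  Ybcoef A y u v k = \sum_(j < J)
    exp_laurent y (ratr h) (k - j%:Z) k *: md (j%:Z - k - 1) u v.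
Proof.
move=> uh uJ; rewrite (@Ybcoef_seq y u v k [:: h] J) ?big_seq1 ?uh //.
  by move=> l; rewrite inE; apply: wtproj_out.
move=> l j jJ; have [->|lh] := eqVneq l h; first by rewrite uh uJ.
by rewrite (wtproj_out uh lh) linear0l.
Qed.

(** * Coefficient extraction *)

Section Extension.
Variable n : nat.
Implicit Types (a b : fseries n V) (nu d e : 'rV[rat]_n).

Lemma Yb_at a y nu b e d0 (k0 : int) :
    (forall d (k : int), a d <> 0 -> b (e - d - k%:~R *: nu) <> 0 ->
      d = d0 /\ k = k0) ->
  Yb A a y nu b e = Ybcoef A y (a d0) (b (e - d0 - k0%:~R *: nu)) k0.
Proof.
move=> dk.
have out d k : (d, k) <> (d0, k0) ->
    Ybcoef A y (a d) (b (e - d - k%:~R *: nu)) k = 0.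
  move=> ne; have [->|/eqP ad] := eqVneq (a d) 0; first exact: Ybcoef0l.
  have [->|/eqP bd] := eqVneq (b (e - d - k%:~R *: nu)) 0; first exact: Ybcoef0r.
  by case: (dk d k ad bd) => d_ k_; case: ne; rewrite d_ k_.
rewrite /Yb (fsum1 (i0 := d0)); last first.
  by move=> d /eqP dd0; apply: fsum0 => k; apply: out => -[].
by rewrite (fsum1 (i0 := k0)) // => k /eqP kk0; apply: out => -[].
Qed.

Lemma Yb_out a y nu b e :
    (forall d (k : int), a d <> 0 -> b (e - d - k%:~R *: nu) = 0) ->
  Yb A a y nu b e = 0.
Proof.
move=> dk; apply: fsum0 => d; apply: fsum0 => k.
have [->|/eqP ad] := eqVneq (a d) 0; first exact: Ybcoef0l.
by rewrite dk // Ybcoef0r.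
Qed.

Lemma fconst_neq0 (u : V) d : fconst u d <> 0 -> d = 0.
Proof. by rewrite /fconst; case: eqP. Qed.

Lemma Yb_const u v y nu e (i : 'I_n) : nu 0 i = 1 ->
  Yb A (fconst u) y nu (fconst v) e =
  if (e 0 i \is a Num.int) && (e == e 0 i *: nu) then
    Ybcoef A y u v (Num.floor (e 0 i))
  else 0.
Proof.
move=> nui; case: ifPn => [/andP[ei /eqP ee]|ne].
  rewrite (@Yb_at _ _ _ _ _ 0 (Num.floor (e 0 i))).
    by rewrite subr0 floorK // -ee subrr /fconst eqxx.
  move=> d k /fconst_neq0 -> /fconst_neq0; rewrite subr0.
  move/rowP/(_ i) => E; split => //; move: E; rewrite !mxE nui mulr1 => /eqP.
  by rewrite subr_eq0 => /eqP ->; rewrite intrKfloor.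
apply: Yb_out => d k /fconst_neq0 ->; rewrite /fconst subr0; case: eqP => // E.
have {}E : e = k%:~R *: nu by apply/eqP; rewrite -subr_eq0 E.
by case/negP: ne; rewrite E !mxE nui mulr1 intr_int eqxx.
Qed.

End Extension.
End CylinderVertex.

(** * The Jacobi identity for X *)

Section JacobiX.
Variables (F : fieldType) (char0 : [pchar F] =i pred0).
Variables (V : lmodType F) (A : vosa V).

Local Notation md := (mode A).
Local Notation Y := (Ycoef md).
Local Notation Xc := (Xcoef A).
Local Notation x0 := (zvar 0 : 'rV[rat]_3).
Local Notation x1 := (zvar 1 : 'rV[rat]_3).
Local Notation x2 := (zvar 2 : 'rV[rat]_3).

Lemma opmul_X u v w (e : 'rV[rat]_3) :
  opmul (X A (fconst u) x1) (X A (fconst v) x2) e w =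
  if e 0 0 == 0 then Xc u (e 0 1) (Xc v (e 0 2) w) else 0.
Proof.
by rewrite /X opmul_const ?span12 // => *; rewrite ?Xcoef0l ?Xcoef0r.
Qed.

Lemma opmul_X_rev u v w (e : 'rV[rat]_3) :
  opmul (X A (fconst v) x2) (X A (fconst u) x1) e w =
  if e 0 0 == 0 then Xc v (e 0 2) (Xc u (e 0 1) w) else 0.
Proof.
rewrite /X opmul_const // 1?addrC ?span12 // => *.
all: by rewrite ?Xcoef0l ?Xcoef0r.
Qed.

Lemma half_integral_weight h u : wtproj A h u = u -> u != 0 ->
  h *+ 2 \is a Num.int.
Proof. by move=> uh u0; apply: (@wt_half_integer _ _ A h u); rewrite uh. Qed.

(** As 2h is an integer, - h and h define the same class modulo the integers. *)
Lemma rel_int (h q : rat) : h *+ 2 \is a Num.int ->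
  (q - rel h \is a Num.int) = (q + h \is a Num.int).
Proof.
move=> h2; have -> : q - rel h = (Num.floor h)%:~R - h *+ 2 + (q + h).
  by rewrite /rel mulr2n; ring.
by rewrite rpredDl // rpredB // intr_int.
Qed.

Variables (u v w : V) (hu hv : rat) (pu pv : bool).
Hypotheses (uh : wtproj A hu u = u) (vh : wtproj A hv v = v).
Hypotheses (up : parproj A pu u = u) (vp : parproj A pv v = v).

Let XY : fseries 3 V :=
  X A (Yb A (fconst u) (pslog1p 1) (x0 - x2) (fconst v)) x2 ^~ w.
Let YY : fseries 3 V := Yser md (Yser md (fconst u) x0 ^~ v) x2 ^~ w.

(** On the coefficient (x0/x2)^(-m-1) u_m v of Y(u, x0/x2) v the operator x2^L(0)
    is x2^(wt(u) + wt(v) - m - 1); it turns x0/x2 back into x0 and leaves the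
    factor x2^(wt(u) + wt(v)) (1 + x0/x2)^wt(u). *)
Lemma X_Yb_log (f : 'rV[rat]_3) J :
    (forall j, (J <= j)%N -> Y u (f 0 0 - j%:R) v = 0) ->
  XY f = \sum_(j < J) psexp (ratr hu) (pslog1p 1) j *:
    YY (f - (hu + hv) *: x2 - j%:R *: (x0 - x2)).
Proof.
move=> uJ; have nu0 : (x0 - x2) 0 0 = 1 by rewrite !mxE /=; ring.
have YYE j : YY (f - (hu + hv) *: x2 - j%:R *: (x0 - x2)) =
    if f 0 1 == 0 then Y (Y u (f 0 0 - j%:R) v) (f 0 2 - (hu + hv) + j%:R) w
    else 0.
  rewrite /YY Yser_iterate.
  congr (if _ == 0 then Y (Y u _ v) _ w else 0); rewrite !mxE /=; ring.
under eq_bigr => j _ do rewrite YYE.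
rewrite /XY /X (opextend_at _ (s0 := f 0 2 + f 0 0)); first last.
- move=> s sN; rewrite (Yb_const _ _ _ _ _ nu0); case: ifP => // /andP[_ /eqP].
  move/rowP/(_ 2); rewrite !mxE /= => E; case/eqP: sN; lra.
- by move=> s w'; rewrite Xcoef0l.
rewrite (Yb_const _ _ _ _ _ nu0).
set g := f - _; have g0 : g 0 0 = f 0 0 by rewrite !mxE /=; ring.
have -> : (g == g 0 0 *: (x0 - x2)) = (f 0 1 == 0).
  apply/eqP/eqP => [/rowP/(_ 1)|f1]; first by rewrite !mxE /=; lra.
  by apply: row3P; rewrite g0 !mxE /= ?f1; ring.
rewrite g0 andbC; case: eqP => [f1|_] /=; last first.
  by rewrite Xcoef0l big1 // => j _; rewrite scaler0.
case: ifPn => [/floorK fint|fN]; last first.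
  rewrite Xcoef0l big1 // => j _.
  rewrite [Y u _ v]/Ycoef ifN ?Ycoef0l ?scaler0 //.
  by rewrite rpredBr ?natr_int.
move: (Num.floor (f 0 0)) fint => k fk.
have YuE j : Y u (f 0 0 - j%:R) v = md (j%:Z - k - 1) u v.
  by rewrite -fk -[j%:R]/(j%:Z%:~R) -intrB Ycoef_int; congr (md _ u v); ring.
rewrite (Ybcoef_hom _ uh (J := J)); last by move=> j /uJ; rewrite YuE.
rewrite Xcoef_suml; apply: eq_bigr => j _.
rewrite exp_laurent_log // XcoefZl YuE (Xcoef_hom _ _ (wt_mode char0 _ up uh vh)).
by congr (_ *: Y _ _ _); rewrite -fk !intrB -pmulrn; ring.
Qed.

(** The powers of 1 + x0/x2 in delta_rel(u) and in Y[u, y] add up: with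
    q = - 1 - e_1 they are q and wt(u), whereas the right-hand side carries
    q + wt(u), because its exponent of x1 is lower by wt(u). *)
Lemma delta0_XY (e : 'rV[rat]_3) :
  fmulable (fshift (- x1)
    (delta_exp (rel hu) 1 (pslog1p 1) (x0 - x2) (x2 - x1))) XY /\
  fmul (fshift (- x1)
    (delta_exp (rel hu) 1 (pslog1p 1) (x0 - x2) (x2 - x1))) XY e
  = fmul (fshift (- x1) (delta_exp 0 1 (pslog1p 1) (x0 - x2) (x2 - x1))) YY
      (e - hu *: x1 - hv *: x2).
Proof.
have [n3 [m3 z3]] := dir02.
have YY1 (d : 'rV[rat]_3) : d 0 1 != 0 -> YY d = 0.
  by move=> d1; rewrite /YY Yser_iterate (negbTE d1).
have XY1 (d : 'rV[rat]_3) : d 0 1 != 0 -> XY d = 0.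
  move=> d1; have [J HJ] := Ycoef_trunc A u v (d 0 0).
  rewrite (X_Yb_log HJ) big1 // => j _; rewrite YY1 ?scaler0 //.
  by rewrite !mxE /= !(mulr0, subr0).
have YY0 (d : 'rV[rat]_3) : Y u (d 0 0) v = 0 -> YY d = 0.
  by rewrite /YY Yser_iterate => ->; rewrite Ycoef0l if_same.
have XYN (g : 'rV[rat]_3) N :
    (forall j, (N <= j)%N -> Y u (g 0 0 - j%:R) v = 0) ->
    forall k j, (N <= k + j)%N ->
      Y u ((g - k%:R *: (x0 - x2)) 0 0 - j%:R) v = 0.
  move=> HN k j /HN; congr (Y u _ v = 0).
  by rewrite !mxE /= natrD; ring.
have bound (g : 'rV[rat]_3) :
    exists N, forall k, (N <= k)%N -> XY (g - k%:R *: (x0 - x2)) = 0.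
  have [N HN] := Ycoef_trunc A u v (g 0 0); exists N => k Nk.
  by rewrite (X_Yb_log (J := 0)) ?big_ord0 // => j _; apply: (XYN g N HN);
    apply: leq_trans Nk (leq_addr _ _).
split.
  move=> f; have [N HN] := bound (f - - x1 - ((- x1) 0 1 - f 0 1) *: (x2 - x1)).
  exact: (@fmulable_delta_exp _ char0 _ _ _ _ n3 m3 _ _ XY1 _ _ _ _ _ _ HN).
set q := (- x1) 0 1 - e 0 1.
set g := e - - x1 - q *: (x2 - x1).
have [N HN] := Ycoef_trunc A u v (g 0 0).
have HXY k : (N <= k)%N -> XY (g - k%:R *: (x0 - x2)) = 0.
  move=> Nk; rewrite (X_Yb_log (J := 0)) ?big_ord0 // => j _.
  by apply: (XYN g N HN); apply: leq_trans Nk (leq_addr _ _).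
rewrite (@fmul_delta_exp _ char0 _ _ _ _ n3 m3 z3 _ _ XY1 _ _ _ _ _ _ HXY).
set e' := e - hu *: x1 - _; set g' := g - (hu + hv) *: x2.
have q'E : (- x1) 0 1 - e' 0 1 = q + hu by rewrite /q !mxE /=; ring.
have g'E : e' - - x1 - (q + hu) *: (x2 - x1) = g'.
  by apply/rowP => j; rewrite !mxE; ring.
have HYY k : (N <= k)%N ->
    YY (e' - - x1 - ((- x1) 0 1 - e' 0 1) *: (x2 - x1) - k%:R *: (x0 - x2)) = 0.
  rewrite q'E g'E => /HN Nk; apply: YY0; rewrite -Nk; congr (Y u _ v).
  by rewrite !mxE /=; ring.
rewrite (@fmul_delta_exp _ char0 _ _ _ _ n3 m3 z3 _ _ YY1 _ _ _ _ _ _ HYY).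
rewrite -/q q'E g'E subr0 !exp1rz !scale1r.
have [u0|u0] := eqVneq u 0.
  have YYu (d : 'rV[rat]_3) : YY d = 0 by apply: YY0; rewrite u0 Ycoef0l.
  rewrite big1 => [|k _]; last first.
    rewrite (X_Yb_log (J := 0)) ?big_ord0 ?scaler0 // => j _.
    by rewrite u0 Ycoef0l.
  by rewrite big1 ?if_same // => k _; rewrite YYu scaler0.
rewrite rel_int; last exact: half_integral_weight uh u0.
case: ifP => // _.
transitivity (\sum_(k < N) \sum_(j < N)
  (psexp (ratr q) (pslog1p 1) k * psexp (ratr hu) (pslog1p 1) j) *:
    YY (g' - (k + j)%:R *: (x0 - x2))).
  apply: eq_bigr => k _; rewrite (X_Yb_log (J := N)); last first.
    by move=> j Nj; apply: (XYN g N HN); apply: leq_trans Nj (leq_addl _ _).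
  rewrite scaler_sumr; apply: eq_bigr => j _; rewrite scalerA; congr (_ *: YY _).
  by apply/rowP => i; rewrite !mxE natrD; ring.
rewrite (sum_antidiagonal (f := fun k j =>
  (psexp (ratr q) (pslog1p 1) k * psexp (ratr hu) (pslog1p 1) j) *:
    YY (g' - (k + j)%:R *: (x0 - x2)))); last first.
  move=> k j kj; rewrite YY0 ?scaler0 // -(HN _ kj); congr (Y u _ v).
  by rewrite !mxE /=; ring.
apply: eq_bigr => n _; rewrite (ratrD char0 q hu) psexpD // /psmul scaler_suml.
by apply: eq_bigr => k _; rewrite subnKC // -ltnS.
Qed.

Lemma jacobi_X
    (delta21 := fshift (- x0)
       (delta_exp 0 1 (pslog1p (- 1)) (x2 - x1) (x1 - x0)) : fseries 3 F)
    (delta12 := fshift (- x0)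
       (delta_exp 0 (- 1) (pslog1p (- 1)) (x1 - x2) (x2 - x0)) : fseries 3 F)
    (delta0 := fshift (- x1)
       (delta_exp (rel hu) 1 (pslog1p 1) (x0 - x2) (x2 - x1)) : fseries 3 F)
    (XuXv := opmul (X A (fconst u) x1) (X A (fconst v) x2) ^~ w : fseries 3 V)
    (XvXu := opmul (X A (fconst v) x2) (X A (fconst u) x1) ^~ w : fseries 3 V) :
  [/\ fmulable delta21 XuXv, fmulable delta12 XvXu, fmulable delta0 XY &
    forall e : 'rV[rat]_3,
      fmul delta21 XuXv e - (-1) ^+ (pu && pv) *: fmul delta12 XvXu e =
      fmul delta0 XY e].
Proof.
have [n1 [m1 _]] := dir21; have [n2 [m2 _]] := dir12.
split.
- move=> e; set g := e - - x0 - ((- x0) 0 0 - e 0 0) *: (x1 - x0).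
  have [N HN] := Ycoef_trunc A v w (g 0 2 - hv).
  apply: (@fmulable_delta_exp _ char0 _ _ _ _ n1 m1 _ _ _ _ _ _ _ _ N).
    by move=> d d0; rewrite /XuXv opmul_X (negbTE d0).
  move=> k Nk; rewrite /XuXv opmul_X (Xcoef_hom _ _ vh).
  rewrite [X in Y v X](_ : _ = g 0 2 - hv - k%:R) ?HN ?Xcoef0r ?if_same //.
  by rewrite !mxE /=; ring.
- move=> e; set g := e - - x0 - ((- x0) 0 0 - e 0 0) *: (x2 - x0).
  have [N HN] := Ycoef_trunc A u w (g 0 1 - hu).
  apply: (@fmulable_delta_exp _ char0 _ _ _ _ n2 m2 _ _ _ _ _ _ _ _ N).
    by move=> d d0; rewrite /XvXu opmul_X_rev (negbTE d0).
  move=> k Nk; rewrite /XvXu opmul_X_rev (Xcoef_hom _ _ uh).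
  rewrite [X in Y u X](_ : _ = g 0 1 - hu - k%:R) ?HN ?Xcoef0r ?if_same //.
  by rewrite !mxE /=; ring.
- exact: (delta0_XY 0).1.
move=> e; apply: etrans (esym (delta0_XY e).2).
apply: etrans (jacobi_exp char0 w _ up vp).
have coord (d : 'rV[rat]_3) i : (e - hu *: x1 - hv *: x2 - d) 0 i =
    (e - d) 0 i - hu * (i == 1)%:R - hv * (i == 2)%:R.
  by rewrite !mxE eqxx /=; ring.
congr (_ - _ *: _); apply: eq_fsbigr => d _; congr (_ *: _).
- rewrite /XuXv opmul_X opmul_Y !coord /= !(mulr0, mulr1, subr0).
  by rewrite (Xcoef_hom _ _ uh) (Xcoef_hom _ _ vh).
- rewrite /XvXu opmul_X_rev opmul_Y_rev !coord /= !(mulr0, mulr1, subr0).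
  by rewrite (Xcoef_hom _ _ uh) (Xcoef_hom _ _ vh).
Qed.

End JacobiX.

(** * The commutator formula in the coordinate e^y *)

Section CommutatorCylinder.
Variables (F : fieldType) (char0 : [pchar F] =i pred0).
Variables (V : lmodType F) (A : vosa V).

Local Notation md := (mode A).
Local Notation Y := (Ycoef md).
Local Notation Xc := (Xcoef A).

(** * Bilinearity and truncation of Y[u, y] v *)

Lemma mode_trunc_wt u v : exists M : nat, forall (h : rat) (m : int), M%:Z <= m ->
  md m (wtproj A h u) v = 0.
Proof.
have [s _ su] := wt_support A u.
suff [M HM] : exists M : nat, forall h, h \in s -> forall m : int, M%:Z <= m ->
    md m (wtproj A h u) v = 0.
  exists M => h m Mm; have [hs|/su ->] := boolP (h \in s); first exact: (HM h).
  by rewrite linear0l.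
elim: s {su} => [|h s [M HM]]; first by exists 0%N.
have [N HN] := mode_trunc_nat A (wtproj A h u) v.
exists (maxn M N) => k; rewrite inE => /orP[/eqP->|ks] m Mm.
  by apply: HN; lia.
by apply: HM => //; lia.
Qed.

Lemma YbcoefDl y u u' v k :
  Ybcoef A y (u + u') v k = Ybcoef A y u v k + Ybcoef A y u' v k.
Proof.
have [s _ us] := wt_support A u; have [s' _ us'] := wt_support A u'.
have [M HM] := mode_trunc_wt u v; have [M' HM'] := mode_trunc_wt u' v.
pose J := (M + M' + `|k| + 1)%N; pose S := undup (s ++ s').
have HJ h (j : nat) : (J <= j)%N -> md (j%:Z - k - 1) (wtproj A h u) v = 0 /\
    md (j%:Z - k - 1) (wtproj A h u') v = 0.
  by rewrite /J => jJ; split; [apply: HM | apply: HM']; lia.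
have HS h : h \notin S -> wtproj A h u = 0 /\ wtproj A h u' = 0.
  by rewrite /S mem_undup mem_cat negb_or => /andP[/us-> /us'->].
rewrite !(@Ybcoef_seq _ _ A y _ v k S J) ?undup_uniq //;
  try by [move=> h /HS[]|move=> h j /(HJ h)[]].
- rewrite -big_split; apply: eq_bigr => h _; rewrite -big_split.
  by apply: eq_bigr => j _; rewrite raddfD /= linearDl scalerDr.
- by move=> h /HS[uh uh']; rewrite raddfD /= uh uh' addr0.
- by move=> h j /(HJ h)[uh uh']; rewrite raddfD /= linearDl uh uh' addr0.
Qed.

Lemma YbcoefDr y u v v' k :
  Ybcoef A y u (v + v') k = Ybcoef A y u v k + Ybcoef A y u v' k.
Proof.
have [s us su] := wt_support A u.
have [M HM] := mode_trunc_wt u v; have [M' HM'] := mode_trunc_wt u v'.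
pose J := (M + M' + `|k| + 1)%N.
have HJ h (j : nat) : (J <= j)%N -> md (j%:Z - k - 1) (wtproj A h u) v = 0 /\
    md (j%:Z - k - 1) (wtproj A h u) v' = 0.
  by rewrite /J => jJ; split; [apply: HM | apply: HM']; lia.
rewrite !(@Ybcoef_seq _ _ A y u _ k s J) //; try by move=> h j /(HJ h)[].
- rewrite -big_split; apply: eq_bigr => h _; rewrite -big_split.
  by apply: eq_bigr => j _; rewrite linearDr scalerDr.
- by move=> h j /(HJ h)[uv uv']; rewrite linearDr uv uv' addr0.
Qed.

Lemma Ybcoef_trunc y u v : exists M : nat, forall k : int, k + M%:Z < 0 ->
  Ybcoef A y u v k = 0.
Proof.
have [s us su] := wt_support A u; have [M HM] := mode_trunc_wt u v.
exists M => k kM; rewrite (@Ybcoef_seq _ _ A y u v k s 0) //.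
  by rewrite big1 // => h _; rewrite big_ord0.
by move=> h j _; apply: HM; lia.
Qed.

Lemma Ybcoef_par y p q h u v k : wtproj A h u = u ->
    parproj A p u = u -> parproj A q v = v ->
  parproj A (p (+) q) (Ybcoef A y u v k) = Ybcoef A y u v k.
Proof.
move=> uh up vq; have [M HM] := mode_trunc_nat A u v.
rewrite (@Ybcoef_hom _ _ A y u v h k (M + `|k| + 1)%N uh); last first.
  by move=> j jM; apply: HM; lia.
rewrite raddf_sum; apply: eq_bigr => j _; rewrite /= linearZ /=.
by rewrite (mode_parity _ up vq).
Qed.

Lemma Ybcoef_wt y p (hu hv g : rat) u v k : wtproj A hu u = u ->
    wtproj A hv v = v -> parproj A p u = u ->
  wtproj A g (Ybcoef A y u v k) != 0 -> g - (hu + hv) \is a Num.int.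
Proof.
move=> uh vh up; apply: contraR => gN; have [M HM] := mode_trunc_nat A u v.
rewrite (@Ybcoef_hom _ _ A y u v hu k (M + `|k| + 1)%N uh); last first.
  by move=> j jM; apply: HM; lia.
rewrite raddf_sum big1 // => j _; rewrite /= linearZ /=.
rewrite (wtproj_out (wt_mode char0 _ up uh vh)) ?scaler0 //.
apply: contra gN => /eqP ->.
rewrite (_ : _ - _ = (- (j%:Z - k - 1) - 1)%:~R) ?intr_int //.
by rewrite [in RHS]intrB intrN; ring.
Qed.

(** * The formula on coefficients *)

Section Formula.
Variables (p q : bool) (w : V) (s t : rat).

Let comm a b := Xc a s (Xc b t w) - (-1) ^+ (p && q) *: Xc b t (Xc a s w).
Let resid a b N := \sum_(i < N) psexp (ratr (- s)) pst i *:
  Xc (Ybcoef A pst a b (- i%:Z - 1)) (s + t) w.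
Let holds a b := exists N0, forall N, (N0 <= N)%N -> comm a b = resid a b N.

(** Res_y e^(-sy) Y[a, y] b is computed in the coordinate z = e^y - 1, where it
    becomes Res_z (1 + z)^(wt(a) - s - 1) Y(a, z) b. *)
Let holds_hom h k a b : parproj A p a = a -> parproj A q b = b ->
  wtproj A h a = a -> wtproj A k b = b -> s - h \is a Num.int -> holds a b.
Proof.
move=> ap bq ah bk sh; have [M HM] := mode_trunc_nat A a b.
exists M => N MN; have abN n : (N <= n)%N -> md n%:Z a b = 0.
  by move=> Nn; apply: HM; lia.
rewrite /comm (commutator_X char0 w t ap bq ah bk sh abN).
(* The index i comes from e^(-sy) and j from the expansion of Y[a, y] b; the mode
   of a depends on i + j only. *)
pose c i j : F := expseries (- ratr s) i *
  psmul (psexp (ratr h) pst) (pspow (- (i + j).+1%:R) (expm1_quot F)) j.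
transitivity (\sum_(i < N) \sum_(j < N)
    c i j *: Xc (md (i + j)%N%:Z a b) (s + t) w); last first.
  apply: eq_bigr => i _; rewrite psexp_var // ratrN //.
  rewrite (@Ybcoef_hom _ _ A pst a b h (- i%:Z - 1) N ah); last first.
    by move=> j Nj; apply: HM; lia.
  rewrite Xcoef_suml scaler_sumr; apply: eq_bigr => j _.
  rewrite XcoefZl scalerA exp_laurentE /c.
  have -> : (- i%:Z - 1 - j%:Z)%:~R = - (i + j).+1%:R :> F.
    by rewrite -addn1 !natrD !intrB intrN -!pmulrn; ring.
  by have -> : j%:Z - (- i%:Z - 1) - 1 = (i + j)%N%:Z by lia.
rewrite (sum_antidiagonal (f := fun i j =>
  c i j *: Xc (md (i + j)%N%:Z a b) (s + t) w)); last first.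
  by move=> i j Nij; rewrite abN // Xcoef0l scaler0.
apply: eq_bigr => n _.
transitivity ((\sum_(i < n.+1) c i (n - i)%N) *: Xc (md n%:Z a b) (s + t) w).
  congr (_ *: _); rewrite ratrD // ratrD // ratrN // ratrN //.
  rewrite -[ratr 1]/(ratr 1%:~R) ratr_int -residue_expm1 //.
  rewrite psexp_var // addrC expseriesD // -!psME -mulrA psME.
  by apply: eq_bigr => i _; rewrite /c subnKC ?psexp_var // -ltnS.
by rewrite scaler_suml; apply: eq_bigr => i _; rewrite subnKC // -ltnS.
Qed.

Let holds0l b : holds 0 b.
Proof.
exists 0%N => N _; rewrite /comm /resid !Xcoef0l Xcoef0r scaler0 subr0.
by rewrite big1 // => i _; rewrite Ybcoef0l Xcoef0l scaler0.
Qed.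

Let holds_suml (I : Type) (r : seq I) (f : I -> V) b :
  (forall i, holds (f i) b) -> holds (\sum_(i <- r) f i) b.
Proof.
move=> fb; elim/big_ind: _ => //.
move=> a a' [N HN] [N' HN']; exists (maxn N N') => M; rewrite geq_max.
move=> /andP[NM NM']; move: (HN M NM) (HN' M NM'); rewrite /comm /resid => E E'.
under eq_bigr => i _ do rewrite YbcoefDl XcoefDl scalerDr.
rewrite big_split /= -E -E' !XcoefDl XcoefDr scalerDr opprD.
by rewrite !addrA; congr (_ - _); rewrite addrAC.
Qed.

Let holds_sumr (I : Type) (r : seq I) a (f : I -> V) :
  (forall i, holds a (f i)) -> holds a (\sum_(i <- r) f i).
Proof.
move=> fb; apply: (big_ind (fun b => holds a b)) => //.
  exists 0%N => N _; rewrite /comm /resid !Xcoef0l Xcoef0r scaler0 subr0.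
  by rewrite big1 // => i _; rewrite Ybcoef0r Xcoef0l scaler0.
move=> b b' [N HN] [N' HN']; exists (maxn N N') => M; rewrite geq_max.
move=> /andP[NM NM']; move: (HN M NM) (HN' M NM'); rewrite /comm /resid => E E'.
under eq_bigr => i _ do rewrite YbcoefDr XcoefDl scalerDr.
rewrite big_split /= -E -E' !XcoefDl XcoefDr scalerDr opprD.
by rewrite !addrA; congr (_ - _); rewrite addrAC.
Qed.

Lemma commutator_expm1 a b : parproj A p a = a -> parproj A q b = b ->
    (forall h, wtproj A h a != 0 -> s - h \is a Num.int) ->
  exists N0, forall N, (N0 <= N)%N ->
    Xc a s (Xc b t w) - (-1) ^+ (p && q) *: Xc b t (Xc a s w) =
    \sum_(i < N) psexp (ratr (- s)) pst i *:
      Xc (Ybcoef A pst a b (- i%:Z - 1)) (s + t) w.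
Proof.
move=> ap bq sa; rewrite -/(holds a b).
have [S uS aS] := wt_support A a; have [T uT bT] := wt_support A b.
have -> : a = \sum_(h <- S) wtproj A h a by rewrite -(fsum_seq uS) ?wtproj_sum.
have -> : b = \sum_(h <- T) wtproj A h b by rewrite -(fsum_seq uT) ?wtproj_sum.
apply: holds_suml => h; apply: holds_sumr => k.
have [a0|ah] := eqVneq (wtproj A h a) 0.
  by rewrite a0; apply: holds0l.
apply: (holds_hom (h := h) (k := k)); rewrite ?wtprojM ?eqxx //;
  try exact: wtproj_par.
exact: sa.
Qed.

End Formula.
End CommutatorCylinder.

(** * The commutator formula for X *)

Lemma row5P (T : Type) (u v : 'rV[T]_5) : u 0 0 = v 0 0 -> u 0 1 = v 0 1 ->
  u 0 2 = v 0 2 -> u 0 3 = v 0 3 -> u 0 4 = v 0 4 -> u = v.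
Proof.
move=> E0 E1 E2 E3 E4; apply/rowP => -[[|[|[|[|[|//]]]]] j5].
- by rewrite (_ : Ordinal j5 = 0) //; apply: val_inj.
- by rewrite (_ : Ordinal j5 = 1) //; apply: val_inj.
- by rewrite (_ : Ordinal j5 = 2) //; apply: val_inj.
- by rewrite (_ : Ordinal j5 = 3) //; apply: val_inj.
- by rewrite (_ : Ordinal j5 = 4) //; apply: val_inj.
Qed.

Section CommutatorX.
Variables (F : fieldType) (char0 : [pchar F] =i pred0).
Variables (V : lmodType F) (A : vosa V).

Local Notation Xc := (Xcoef A).
Local Notation x1 := (zvar 0 : 'rV[rat]_5).
Local Notation x2 := (zvar 1 : 'rV[rat]_5).
Local Notation y1 := (zvar 2 : 'rV[rat]_5).
Local Notation y2 := (zvar 3 : 'rV[rat]_5).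
Local Notation y := (zvar 4 : 'rV[rat]_5).

Section Axes.
(** Of Y[u1, x1] v1 and Y[u2, x2] v2 only the supports matter in what follows:
    an exponent of a product then determines the coefficients that enter it. *)
Variables (a1 a2 : fseries 5 V).
Hypothesis a1_axis : forall d, a1 d <> 0 -> d = d 0 0 *: x1.
Hypothesis a2_axis : forall d, a2 d <> 0 -> d = d 0 1 *: x2.

Lemma axis_coord1 (j : 'I_5) (d : 'rV[rat]_5) : j != 0 -> d 0 j != 0 -> a1 d = 0.
Proof.
move=> j0 dj; apply: contrapT => /a1_axis/rowP/(_ j) E.
by case/negP: dj; rewrite E !mxE eqxx /= (negbTE j0) mulr0.
Qed.

Lemma axis_coord2 (j : 'I_5) (d : 'rV[rat]_5) : j != 1 -> d 0 j != 0 -> a2 d = 0.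
Proof.
move=> j1 dj; apply: contrapT => /a2_axis/rowP/(_ j) E.
by case/negP: dj; rewrite E !mxE eqxx /= (negbTE j1) mulr0.
Qed.

Lemma X_axis1 d : X A a1 y1 d = Xc (a1 (d - d 0 2 *: y1)) (d 0 2).
Proof.
apply/funext => w; rewrite /X opextend_coord // => [s w'|f].
  exact: Xcoef0l.
exact: axis_coord1.
Qed.

Lemma X_axis2 d : X A a2 y2 d = Xc (a2 (d - d 0 3 *: y2)) (d 0 3).
Proof.
apply/funext => w; rewrite /X opextend_coord // => [s w'|f].
  exact: Xcoef0l.
exact: axis_coord2.
Qed.

(** The exponent e determines one pair of coefficients; the series are free of y,
    whence the condition on its last coordinate. *)
Lemma supercomm_axes p q (e : 'rV[rat]_5) w :
    (forall d, parproj A p (a1 d) = a1 d) ->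
    (forall d, parproj A q (a2 d) = a2 d) ->
  fsupercomm A (X A a1 y1) (X A a2 y2) e w =
  if e 0 4 == 0 then
    Xc (a1 (e 0 0 *: x1)) (e 0 2) (Xc (a2 (e 0 1 *: x2)) (e 0 3) w)
    - (-1) ^+ (p && q) *:
      Xc (a2 (e 0 1 *: x2)) (e 0 3) (Xc (a1 (e 0 0 *: x1)) (e 0 2) w)
  else 0.
Proof.
move=> a1p a2q; rewrite /fsupercomm (fsum1 (i0 := e 0 0 *: x1 + e 0 2 *: y1)).
  set d := _ + _; rewrite X_axis1 X_axis2 (supercomm_Xcoef _ _ _ (a1p _) (a2q _)).
  have -> : d - d 0 2 *: y1 = e 0 0 *: x1 by apply: row5P; rewrite !mxE /=; ring.
  have -> : d 0 2 = e 0 2 by rewrite !mxE /=; ring.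
  have -> : (e - d) 0 3 = e 0 3 by rewrite !mxE /=; ring.
  have -> : e - d - e 0 3 *: y2 = e 0 1 *: x2 + e 0 4 *: y.
    by apply: row5P; rewrite !mxE /=; ring.
  case: eqP => [->|/eqP e4]; first by rewrite scale0r addr0.
  rewrite (@axis_coord2 4) ?Xcoef0l ?Xcoef0r ?scaler0 ?subr0 //.
  by rewrite !mxE /= mulr0 add0r mulr1.
move=> d dN; rewrite X_axis1 X_axis2 (supercomm_Xcoef _ _ _ (a1p _) (a2q _)).
have [->|/eqP/a1_axis E1] := eqVneq (a1 (d - d 0 2 *: y1)) 0.
  by rewrite !Xcoef0l Xcoef0r scaler0 subr0.
have [->|/eqP/a2_axis E2] := eqVneq (a2 (e - d - (e - d) 0 3 *: y2)) 0.
  by rewrite !Xcoef0l Xcoef0r scaler0 subr0.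
case/eqP: dN; move/rowP: E1 => E1; move/rowP: E2 => E2.
move: (E1 0) (E1 1) (E1 2) (E1 3) (E1 4) (E2 0) (E2 2).
rewrite !mxE /= => *; apply: row5P; rewrite !mxE /=; lra.
Qed.

Lemma Yb_axes (g : 'rV[rat]_5) :
  Yb A a1 pst y a2 g =
  if [&& g 0 2 == 0, g 0 3 == 0 & g 0 4 \is a Num.int] then
    Ybcoef A pst (a1 (g 0 0 *: x1)) (a2 (g 0 1 *: x2)) (Num.floor (g 0 4))
  else 0.
Proof.
have key (d : 'rV[rat]_5) (k : int) : a1 d <> 0 -> a2 (g - d - k%:~R *: y) <> 0 ->
    [/\ d = g 0 0 *: x1, g 0 4 = k%:~R, g 0 2 = 0 & g 0 3 = 0].
  move=> /a1_axis E1 /a2_axis /rowP E2; rewrite E1 in E2.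
  move: (E2 0) (E2 2) (E2 3) (E2 4); rewrite !mxE /= => F0 F2 F3 F4.
  have d0 : d 0 0 = g 0 0 by lra.
  by split; [rewrite E1 d0 | lra..].
case: ifPn => [/and3P[/eqP g2 /eqP g3 g4]|gN].
  rewrite (@Yb_at _ _ A _ _ _ _ _ _ (g 0 0 *: x1) (Num.floor (g 0 4))).
    rewrite floorK //; have -> // : g - g 0 0 *: x1 - g 0 4 *: y = g 0 1 *: x2.
    by apply: row5P; rewrite !mxE /= ?g2 ?g3; ring.
  by move=> d k a1d /(key _ _ a1d)[-> -> _ _]; rewrite intrKfloor.
apply: Yb_out => d k a1d; apply: contrapT => /(key _ _ a1d)[_ g4 g2 g3].
by case/negP: gN; rewrite g2 g3 g4 eqxx intr_int.
Qed.

Lemma X_Yb_axes (f : 'rV[rat]_5) w :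
  X A (Yb A a1 pst y a2) y2 f w =
  if (f 0 2 == 0) && (f 0 4 \is a Num.int) then
    Xc (Ybcoef A pst (a1 (f 0 0 *: x1)) (a2 (f 0 1 *: x2)) (Num.floor (f 0 4)))
      (f 0 3) w
  else 0.
Proof.
rewrite /X opextend_coord => [|s w'|d d3]; first last.
- by rewrite Yb_axes (negbTE d3) andbF.
- exact: Xcoef0l.
rewrite Yb_axes; set g := f - _.
have -> : g 0 0 = f 0 0 by rewrite !mxE /=; ring.
have -> : g 0 1 = f 0 1 by rewrite !mxE /=; ring.
have -> : g 0 2 = f 0 2 by rewrite !mxE /=; ring.
have -> : g 0 3 = 0 by rewrite !mxE /=; ring.
have -> : g 0 4 = f 0 4 by rewrite !mxE /=; ring.
by rewrite eqxx /=; case: ifP => // _; apply: Xcoef0l.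
Qed.

End Axes.

Lemma commutator_X_Yb (u1 v1 u2 v2 w : V) (hu1 hv1 hu2 hv2 : rat)
    (pu1 pv1 pu2 pv2 : bool)
    (a1 := Yb A (fconst u1) pst x1 (fconst v1))
    (a2 := Yb A (fconst u2) pst x2 (fconst v2))
    (delta := delta_exp (rel hu1 + rel hv1) 1 pst y (y2 - y1) : fseries 5 F)
    (XY := X A (Yb A a1 pst y a2) y2 ^~ w : fseries 5 V) :
    homogeneous A hu1 pu1 u1 -> homogeneous A hv1 pv1 v1 ->
    homogeneous A hu2 pu2 u2 -> homogeneous A hv2 pv2 v2 ->
  fmulable delta XY /\
  forall e : 'rV[rat]_5,
    fsupercomm A (X A a1 y1) (X A a2 y2) e w = Res 4 (fmul delta XY) e.
Proof.
move=> [u1h u1p] [v1h v1p] [u2h u2p] [v2h v2p].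
have x11 : x1 0 0 = 1 by rewrite mxE.
have x21 : x2 0 1 = 1 by rewrite mxE.
have a1E d : a1 d = if (d 0 0 \is a Num.int) && (d == d 0 0 *: x1) then
    Ybcoef A pst u1 v1 (Num.floor (d 0 0)) else 0 by apply: Yb_const.
have a2E d : a2 d = if (d 0 1 \is a Num.int) && (d == d 0 1 *: x2) then
    Ybcoef A pst u2 v2 (Num.floor (d 0 1)) else 0 by apply: Yb_const.
have a1_axis d : a1 d <> 0 -> d = d 0 0 *: x1.
  by rewrite a1E; case: andP => // -[_ /eqP].
have a2_axis d : a2 d <> 0 -> d = d 0 1 *: x2.
  by rewrite a2E; case: andP => // -[_ /eqP].
have a1p d : parproj A (pu1 (+) pv1) (a1 d) = a1 d.
  rewrite a1E; case: ifP => _; last by rewrite raddf0.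
  exact: Ybcoef_par u1h u1p v1p.
have a2p d : parproj A (pu2 (+) pv2) (a2 d) = a2 d.
  rewrite a2E; case: ifP => _; last by rewrite raddf0.
  exact: Ybcoef_par u2h u2p v2p.
have a1wt d h s : wtproj A h (a1 d) != 0 ->
    (s - h \is a Num.int) = (- s - (rel hu1 + rel hv1) \is a Num.int).
  rewrite a1E; case: ifP => _; last by rewrite raddf0 eqxx.
  move=> nz; have hI := Ybcoef_wt char0 u1h v1h u1p nz.
  have u10 : u1 != 0 by apply: contraNneq nz => ->; rewrite Ybcoef0l raddf0.
  have v10 : v1 != 0 by apply: contraNneq nz => ->; rewrite Ybcoef0r raddf0.
  rewrite opprD addrA rel_int; last exact: half_integral_weight v1h v10.
  rewrite addrAC rel_int; last exact: half_integral_weight u1h u10.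
  have -> : s - h = - (- s + hv1 + hu1) - (h - (hu1 + hv1)) by ring.
  by rewrite rpredBr // rpredN.
have XYE f : XY f = _ := X_Yb_axes a1_axis a2_axis f w.
have XY2 (d : 'rV[rat]_5) : d 0 2 != 0 -> XY d = 0 by rewrite XYE => /negbTE ->.
have ny : y 0 2 = 0 by rewrite mxE.
have my : (y2 - y1) 0 2 = -1 by rewrite !mxE.
have y0 : y != 0.
  by apply/eqP => /rowP/(_ 4); rewrite !mxE => /eqP; rewrite oner_eq0.
have shift0 : fshift 0 delta = delta.
  by apply/funext => d; rewrite /fshift subr0.
have bound (g : 'rV[rat]_5) :
    exists N, forall k, (N <= k)%N -> XY (g - k%:R *: y) = 0.
  have [M HM] := Ybcoef_trunc A pst (a1 (g 0 0 *: x1)) (a2 (g 0 1 *: x2)).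
  set c := g 0 4; exists (`|Num.floor c| + M + 1)%N => k Mk; rewrite XYE.
  have -> : (g - k%:R *: y) 0 0 = g 0 0 by rewrite !mxE /=; ring.
  have -> : (g - k%:R *: y) 0 1 = g 0 1 by rewrite !mxE /=; ring.
  have -> : (g - k%:R *: y) 0 4 = c - k%:R by rewrite /c !mxE /=; ring.
  case: ifP => // /andP[_ ck]; rewrite HM ?Xcoef0l // floorB_nat //.
  by move: (Num.floor c) Mk => f Mk; lia.
split.
  move=> e; rewrite -shift0.
  have [N HN] := bound (e - 0 - ((0 : 'rV[rat]_5) 0 2 - e 0 2) *: (y2 - y1)).
  exact: (@fmulable_delta_exp _ char0 _ _ _ _ ny my _ _ XY2 _ _ _ _ _ _ HN).
move=> e; rewrite (supercomm_axes a1_axis a2_axis _ _ a1p a2p) /Res.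
case: eqP => // e4; set e' := e - y; set s := e 0 2; set t := e 0 3.
set a := a1 _; set b := a2 _; rewrite -shift0.
have qE : (0 : 'rV[rat]_5) 0 2 - e' 0 2 = - s by rewrite /s !mxE /=; ring.
have XYk k : XY (e' - 0 - (- s) *: (y2 - y1) - k%:R *: y) =
    Xc (Ybcoef A pst a b (- k%:Z - 1)) (s + t) w.
  set f := _ - _ *: y; rewrite XYE.
  have -> : f 0 0 = e 0 0 by rewrite !mxE /=; ring.
  have -> : f 0 1 = e 0 1 by rewrite !mxE /=; ring.
  have -> : f 0 2 = 0 by rewrite /f /e' /s !mxE /=; ring.
  have -> : f 0 3 = s + t by rewrite /f /e' /s /t !mxE /=; ring.
  have -> : f 0 4 = (- k%:Z - 1)%:~R.
    by rewrite /f /e' /s !mxE /= e4 intrB intrN -!pmulrn; ring.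
  by rewrite eqxx intr_int intrKfloor.
have [N0 HN0] := bound (e' - 0 - (- s) *: (y2 - y1)).
have XYN N : (N0 <= N)%N -> forall k, (N <= k)%N ->
    XY (e' - 0 - ((0 : 'rV[rat]_5) 0 2 - e' 0 2) *: (y2 - y1) - k%:R *: y) = 0.
  by move=> N0N k Nk; rewrite qE; apply/HN0/(leq_trans N0N).
have fmulE N (N0N : (N0 <= N)%N) :=
  @fmul_delta_exp _ char0 _ _ _ _ ny my y0 _ _ XY2 (rel hu1 + rel hv1) 1 pst
    _ _ _ (XYN N N0N).
rewrite qE in fmulE.
(* For s outside the class of the weights of a both sides vanish. *)
have [sint|sN] := boolP (- s - (rel hu1 + rel hv1) \is a Num.int).
  have [N1 HN1] := commutator_expm1 char0 (p := pu1 (+) pv1) (q := pu2 (+) pv2)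
    w t (a1p (e 0 0 *: x1)) (a2p (e 0 1 *: x2)) (fun h (nz : wtproj A h a != 0) =>
      etrans (a1wt _ _ s nz) sint).
  rewrite (HN1 (maxn N0 N1)) ?leq_maxr // (fmulE _ (leq_maxl N0 N1)) sint.
  by rewrite exp1rz scale1r; apply: eq_bigr => k _; rewrite XYk.
rewrite (fmulE _ (leqnn _)) (negbTE sN).
have Xa0 w' : Xc a s w' = 0.
  apply: fsum0 => h; have [->|nz] := eqVneq (wtproj A h a) 0.
    exact: Ycoef0l.
  by rewrite /Ycoef (a1wt _ _ s nz) (negbTE sN).
rewrite !Xa0 Xcoef0r scaler0 subr0.
exact: erefl.
Qed.

End CommutatorX.

Theorem proposition4p2 (F : fieldType) (char0 : [pchar F] =i pred0)
    (V : lmodType F) (A : vosa V) :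
  (forall (u v : V) (hu hv : rat) (pu pv : bool),
     homogeneous A hu pu u -> homogeneous A hv pv v ->
   forall w : V,
   let x0 : 'rV[rat]_3 := zvar 0 in
   let x1 : 'rV[rat]_3 := zvar 1 in
   let x2 : 'rV[rat]_3 := zvar 2 in
   let delta21 : fseries 3 F :=
     fshift (- x0) (delta_exp 0 1 (pslog1p (-1)) (x2 - x1) (x1 - x0)) in
   let delta12 : fseries 3 F :=
     fshift (- x0) (delta_exp 0 (-1) (pslog1p (-1)) (x1 - x2) (x2 - x0)) in
   let delta0 : fseries 3 F :=
     fshift (- x1) (delta_exp (rel hu) 1 (pslog1p 1) (x0 - x2) (x2 - x1)) in
   let XuXv : fseries 3 V :=
     opmul (X A (fconst u) x1) (X A (fconst v) x2) ^~ w in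
   let XvXu : fseries 3 V :=
     opmul (X A (fconst v) x2) (X A (fconst u) x1) ^~ w in
   let XY : fseries 3 V :=
     X A (Yb A (fconst u) (pslog1p 1) (x0 - x2) (fconst v)) x2 ^~ w in
   [/\ fmulable delta21 XuXv, fmulable delta12 XvXu, fmulable delta0 XY &
     forall e : 'rV[rat]_3,
       fmul delta21 XuXv e - (-1) ^+ (pu && pv) *: fmul delta12 XvXu e
       = fmul delta0 XY e])
  /\
  (forall (u1 v1 u2 v2 : V) (hu1 hv1 hu2 hv2 : rat) (pu1 pv1 pu2 pv2 : bool),
     homogeneous A hu1 pu1 u1 -> homogeneous A hv1 pv1 v1 ->
     homogeneous A hu2 pu2 u2 -> homogeneous A hv2 pv2 v2 ->
   forall w : V,
   let x1 : 'rV[rat]_5 := zvar 0 in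
   let x2 : 'rV[rat]_5 := zvar 1 in
   let y1 : 'rV[rat]_5 := zvar 2 in
   let y2 : 'rV[rat]_5 := zvar 3 in
   let iy : 'I_5 := 4 in
   let y : 'rV[rat]_5 := zvar iy in
   let a1 : fseries 5 V := Yb A (fconst u1) pst x1 (fconst v1) in
   let a2 : fseries 5 V := Yb A (fconst u2) pst x2 (fconst v2) in
   let delta : fseries 5 F :=
     delta_exp (rel hu1 + rel hv1) 1 pst y (y2 - y1) in
   let XY : fseries 5 V := X A (Yb A a1 pst y a2) y2 ^~ w in
   fmulable delta XY /\
   forall e : 'rV[rat]_5,
     fsupercomm A (X A a1 y1) (X A a2 y2) e w = Res iy (fmul delta XY) e).
Proof.
split=> [u v hu hv pu pv [uh up] [vh vp] w|].
  exact: (jacobi_X char0 w uh vh up vp).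
move=> u1 v1 u2 v2 hu1 hv1 hu2 hv2 pu1 pv1 pu2 pv2 u1h v1h u2h v2h w.
exact: (commutator_X_Yb char0 w u1h v1h u2h v2h).
Qed.
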